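(* Let $\{\omega_{\mathbf z}\}_{\mathbf z\in\mathbb Z^2}$ be i.i.d. non-negative random variables with continuous cumulative distribution function, such that $\mathbb E[e^{\alpha\omega_{\mathbf z}}]<\infty$ for some $\alpha>0$ and $\mathbb P(\omega_{\mathbf z}>\beta)>0$ for all $\beta<\infty$. Fix $0<t\le1/2$ such that $\mu_0>\mu_t$. Then for each $\epsilon>0$ there exists $n_0$ such that for each even integer $n\ge n_0$, $$e^{-n(\mathcal J_t(\mu_0)+\epsilon)}\le\mathbb P\big(\mathrm{End}_{0,n}\cdot\mathbf e_1=\lfloor n/2+tn\rfloor\big)\le\mathbb P\big(\mathrm{End}_{0,n}\cdot\mathbf e_1\ge\lfloor n/2+tn\rfloor\big)\le e^{-n(\mathcal J_t(\mu_0)-\epsilon)}.$$ Consequently, with limits along even integers $n$, $$\mathcal J_t(\mu_0)=-\lim_{n\to\infty}\frac1n\log\mathbb P\big(\mathrm{End}_{0,n}\cdot\mathbf e_1=\lfloor n/2+tn\rfloor\big)=-\lim_{n\to\infty}\frac1n\log\mathbb P\big(\mathrm{End}_{0,n}\cdot\mathbf e_1\ge\lfloor n/2+tn\rfloor\big).$$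
   Context: Let $\mathbf e_1,\mathbf e_2$ be the standard basis vectors of $\mathbb R^2$ and $\mathbf 0=(0,0)$. For coordinatewise-ordered points $\mathbf u\le\mathbf v$ in $\mathbb Z^2$, an up-right path from $\mathbf u$ to $\mathbf v$ is a finite sequence $\gamma=(\gamma_i)_{i=0}^{|\mathbf u-\mathbf v|_1}$ in $\mathbb Z^2$ with $\gamma_0=\mathbf u$, $\gamma_{|\mathbf u-\mathbf v|_1}=\mathbf v$ and $\gamma_{i+1}-\gamma_i\in\{\mathbf e_1,\mathbf e_2\}$. The last-passage value is $$G_{\mathbf u,\mathbf v}=\max_{\gamma:\mathbf u\to\mathbf v\text{ up-right}}\ \sum_{\mathbf z\in\gamma\setminus\{\mathbf u\}}\omega_{\mathbf z},$$ with $G_{\mathbf u,\mathbf v}=-\infty$ if there is no up-right path from $\mathbf u$ to $\mathbf v$. A maximizing path is called a geodesic. Let $\mathcal L_{n/2}=\{(x,y)\in\mathbb R^2:x+y=n\}$. The point-to-line last-passage value is $$G_{\mathbf 0,\mathcal L_{n/2}}=\max_{k\in\mathbb Z}G_{\mathbf 0,(\lfloor n/2+k\rfloor,\lfloor n/2-k\rfloor)},$$ and the point-to-line geodesic is the (almost surely unique) up-right path from $\mathbf 0$ to $\mathcal L_{n/2}$ attaining this maximum. $\mathrm{End}_{0,n}$ denotes its endpoint on $\mathcal L_{n/2}$. For $-1/2\le t\le1/2$, the shape function is the almost sure (deterministic) limit $$\mu_t=\lim_{n\to\infty}\frac{G_{\mathbf 0,(\lfloor n/2+tn\rfloor,\lfloor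 n/2-tn\rfloor)}}{n},$$ and for $r>0$ the right tail large deviation rate function is $$\mathcal J_t(r)=-\lim_{n\to\infty}\frac1n\log\mathbb P\big(G_{\mathbf 0,(\lfloor n/2+tn\rfloor,\lfloor n/2-tn\rfloor)}\ge rn\big);$$ both limits exist, and $\mathcal J_t(r)\in[0,\infty)$. *)

(* Defs.v *)
From HB Require Import structures.
From mathcomp Require Import all_boot all_order all_algebra.
From mathcomp Require Import all_classical all_reals all_analysis.

Set Implicit Arguments.
Unset Strict Implicit.
Unset Printing Implicit Defensive.

Import Order.TTheory GRing.Theory Num.Theory.
Import numFieldNormedType.Exports.

Local Open Scope classical_set_scope.
Local Open Scope ring_scope.

Definition mutually_independent (R : realType) (d : measure_display)
    (T : measurableType d) (P : probability T R) (I : eqType)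
    (X : I -> {RV P >-> R}) : Prop :=
  forall (s : seq I) (B : I -> set R), uniq s ->
    (forall i, measurable (B i)) ->
    P (\bigcap_(i in [set` s]) (X i @^-1` B i)) =
    (\prod_(i <- s) P (X i @^-1` B i))%E.

Definition identically_distributed (R : realType) (d : measure_display)
    (T : measurableType d) (P : probability T R) (I : Type)
    (X : I -> {RV P >-> R}) : Prop :=
  forall (i j : I) (B : set R), measurable B ->
    distribution P (X i) B = distribution P (X j) B.

Definition up_right_step (x y : int * int) : bool :=
  (y == (x.1 + 1, x.2)) || (y == (x.1, x.2 + 1)).

(* The path gamma_0, ..., gamma_l is encoded as its starting point u = gamma_0
   and the sequence p = [:: gamma_1; ...; gamma_l]. The length l is forced to
   be |v - u|_1, and p lists the (distinct) points of gamma \ {u}. *)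
Definition up_right_path (u v : int * int) (p : seq (int * int)) : bool :=
  path up_right_step u p && (last u p == v).

Section Deterministic.
Variable R : realType.
(* one realization of the weights *)
Implicit Types om : int * int -> R.

Definition path_weight om (p : seq (int * int)) : R := \sum_(z <- p) om z.

(* A maximum over a finite set, which is -oo when there is no path because
   ereal_sup set0 = -oo. *)
Definition lpp om (u v : int * int) : \bar R :=
  ereal_sup [set (path_weight om p)%:E | p in [set p | up_right_path u v p]].

Definition target (s : R) (n : nat) : int * int :=
  (Num.floor (n%:R / 2 + s * n%:R), Num.floor (n%:R / 2 - s * n%:R)).

(* A maximum: all but finitely many k contribute -oo. *)
Definition lpp_line om (n : nat) : \bar R :=
  ereal_sup (range (fun k : int =>
    lpp om (0, 0) (Num.floor (n%:R / 2 + k%:~R : R),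
                   Num.floor (n%:R / 2 - k%:~R : R)))).

Definition line_geodesic om (n : nat) (p : seq (int * int)) : Prop :=
  exists v : int * int, [/\ v.1 + v.2 = n%:Z, up_right_path (0, 0) v p &
    (path_weight om p)%:E = lpp_line om n].

(* For even n a point-to-line geodesic always exists. On the null event where
   it is not unique, one of them is chosen. *)
Definition line_endpoint om (n : nat) : int * int :=
  last (0, 0) (xget [::] [set p | line_geodesic om n p]).

End Deterministic.

Section Random.
Variables (R : realType) (d : measure_display) (T : measurableType d).
Variables (P : probability T R) (omega : int * int -> {RV P >-> R}).

Definition weights (w : T) : int * int -> R := fun z => omega z w.

Definition is_shape_value (s m : R) : Prop :=
  {ae P, forall w, (fun n : nat =>
     lpp (weights w) (0%R, 0%R) (target s n) * (n%:R^-1)%:E)%E @ \oo --> m%:E}.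

(* Extended logarithm (lne 0 = -oo), because the probability may vanish for
   small n. *)
Definition rate (s r : R) : \bar R :=
  (- limn (fun n : nat => (n%:R^-1)%:E * lne (P [set w |
     ((r * n%:R)%:E <= lpp (weights w) (0%R, 0%R) (target s n))%E])))%E.

Definition end_eq (t : R) (n : nat) : set T :=
  [set w | (line_endpoint (weights w) n).1 =
           Num.floor (n%:R / 2 + t * n%:R)].

Definition end_ge (t : R) (n : nat) : set T :=
  [set w | Num.floor (n%:R / 2 + t * n%:R) <=
           (line_endpoint (weights w) n).1].

End Random.

(* Main.v *)
Require Import Defs.
From HB Require Import structures.
From mathcomp Require Import all_boot all_order all_algebra.
From mathcomp Require Import all_classical all_reals all_analysis.
From mathcomp Require Import measurable_realfun ring lra zify.

Set Implicit Arguments.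
Unset Strict Implicit.
Unset Printing Implicit Defensive.

Import Order.TTheory GRing.Theory Num.Theory.
Import numFieldNormedType.Exports.

Local Open Scope classical_set_scope.
Local Open Scope ring_scope.

(** Write J for the right tail rate function in direction [t] and mu0 for the
shape value on the diagonal. Everything rests on one superadditivity: a path
from the origin to [u] followed by a path from [u] uses disjoint sets of
weights, so the probabilities of the events [reach] are supermultiplicative
([pass_super]). Fekete's lemma makes J a finite limit, which is also an
infimum, so that [P (G_n >= r n) <= exp (- n J(r))] holds for every [n >= 2]
and not only asymptotically; concatenating deviations of different strengths
gives convexity and hence the continuity of J on both sides of mu0
([rate_fun_left], [rate_fun_right]).

Upper bound. The value on the line is at least the value at the diagonal
point, which falls below (mu0 - delta) n with a probability smaller than any
exponential: there are arbitrarily many disjoint chains of boxes of constant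
size along the diagonal, and all of them would have to fail ([lower_tail]).
Otherwise some point of the line beyond direction [t] has value at least
(mu0 - delta) n. Mixing copies of the path leading there with copies of its
mirror image yields, up to rounding, paths in direction [t] with the same
weight per step, so each such point costs at least J(mu0 - delta) per step, uniformly
([pass_far_le]); there are linearly many of them, and J is left continuous.

Lower bound. Take r slightly larger than mu0 and cut the first part of the
segment of direction [t] into finitely many blocks of macroscopic length [m].
That each block has a passage value at least r m costs about J(r) per step,
and produces a path whose weight is spread evenly at scale [m]
([law_heavy_chain]). A fixed final segment, a small proportion of the whole,
carries large weights, at a cost that is a small proportion of [n]. If the
weights elsewhere are not exceptional, then from any vertex of this path on,
following it is better than leaving it for good, so the geodesic to the line
ends at its endpoint ([line_endpoint_eq], [planted_endpoint]).

That the weights elsewhere are not exceptional is expressed by finitely many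
constraints, each satisfied with probability at least one half; apart from a bounded number, there
are as many of them as there are steps in the final segment, so even the
product of these halves is affordable. To obtain that product one conditions
on which path is the first heavy one: given a path, this event is decreasing
in the weights off it, and so are the constraints, whence the Harris
inequality applies ([harris_seq], [planted_prob]). The Harris inequality is
itself proved by replacing the common sites of two events one by one with
unused, exchangeable sites of the lattice ([law_swap_le]). *)

(** * Events of the weight field *)

Definition site := (int * int)%type.

Section FieldEvents.
Variable R : realType.
Implicit Types (F G : set site) (A B : set (site -> R)).

(** The events determined by the weights in [F] form the product sigma-algebra
of that region, all regions being regarded as parts of one field. *)
Definition cylinders F : set (set (site -> R)) :=
  [set A | exists (s : seq site) (B : site -> set R),
    [/\ forall z, z \in s -> F z, forall z, measurable (B z) &
        A = [set eta | forall z, z \in s -> B z (eta z)]]].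

Definition events F : set (set (site -> R)) := <<s cylinders F >>.

Lemma cylinders_setI F : setI_closed (cylinders F).
Proof.
move=> _ _ [s1 [B1 [s1F mB1 ->]]] [s2 [B2 [s2F mB2 ->]]].
exists (s1 ++ s2).
exists (fun z => (if z \in s1 then B1 z else setT) `&`
                 (if z \in s2 then B2 z else setT)); split.
- by move=> z; rewrite mem_cat => /orP[/s1F|/s2F].
- by move=> z; apply: measurableI; case: ifP.
- apply/seteqP; split=> eta /=.
    by move=> [h1 h2] z _; split; case: ifP => // zs; [exact: h1|exact: h2].
  move=> h; split=> z zs; have := h z; rewrite mem_cat zs ?orbT => /(_ isT);
    by rewrite /setI/= ?zs => -[].
Qed.

Lemma eventsT F : events F setT.
Proof. exact: (@measurableT _ (g_sigma_algebraType (cylinders F))). Qed.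

Lemma events0 F : events F set0.
Proof. exact: (@measurable0 _ (g_sigma_algebraType (cylinders F))). Qed.

Lemma eventsI F A B : events F A -> events F B -> events F (A `&` B).
Proof. exact: (@measurableI _ (g_sigma_algebraType (cylinders F))). Qed.

Lemma eventsU F A B : events F A -> events F B -> events F (A `|` B).
Proof. exact: (@measurableU _ (g_sigma_algebraType (cylinders F))). Qed.

Lemma eventsC F A : events F A -> events F (~` A).
Proof. exact: (@measurableC _ (g_sigma_algebraType (cylinders F))). Qed.

Lemma events_bigcup F (A : nat -> set (site -> R)) :
  (forall n, events F (A n)) -> events F (\bigcup_n A n).
Proof.
move=> h; apply: (@bigcup_measurable _ (g_sigma_algebraType (cylinders F))).
by move=> n _; exact: h.
Qed.

Lemma events_exists F (I : countType) (D : set I) (A : I -> set (site -> R)) :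
  (forall i, D i -> events F (A i)) ->
  events F [set eta | exists2 i, D i & A i eta].
Proof.
move=> h; have -> : [set eta | exists2 i, D i & A i eta] =
    \bigcup_i (if pselect (D i) then A i else set0).
  apply/seteqP; split=> eta /=.
    by move=> [i Di Ai]; exists i => //; case: pselect.
  by move=> [i _]; case: pselect => // Di Ai; exists i.
apply: (@countable_bigcupT_measurable _ (g_sigma_algebraType (cylinders F))).
  exact: countableP.
by move=> i; case: pselect => Di; [exact: h|exact: events0].
Qed.

Lemma events_forall F (I : countType) (D : set I) (A : I -> set (site -> R)) :
  (forall i, D i -> events F (A i)) ->
  events F [set eta | forall i, D i -> A i eta].
Proof.
move=> h; rewrite -[X in events _ X]setCK; apply: eventsC.
have -> : ~` [set eta | forall i, D i -> A i eta] =
    [set eta | exists2 i, D i & (~` A i) eta].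
  apply/seteqP; split=> eta /=; last by move=> [i Di nA] /(_ i Di).
  by move=> /existsNP[i /not_implyP[Di nA]]; exists i.
by apply: events_exists => i /h; exact: eventsC.
Qed.

Lemma events_ind F (Q : set (set (site -> R))) : Q setT ->
  cylinders F `<=` Q ->
  (forall A, events F A -> Q A -> Q (~` A)) ->
  (forall A : nat -> set (site -> R), (forall n, events F (A n)) ->
     trivIset setT A -> (forall n, Q (A n)) -> Q (\bigcup_n A n)) ->
  events F `<=` Q.
Proof.
move=> QT Qc QC QU; apply: (@dynkin_induction _
  (g_sigma_algebraType (cylinders F)) (cylinders F) Q) => //.
exact: cylinders_setI.
Qed.

Lemma events_site F z (B : set R) : F z -> measurable B ->
  events F [set eta | B (eta z)].
Proof.
move=> Fz mB; apply: sub_sigma_algebra.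
exists [:: z], (fun=> B); split=> //; first by move=> y; rewrite inE => /eqP->.
apply/seteqP; split=> eta /=; first by move=> h y; rewrite inE => /eqP->.
by apply; rewrite inE.
Qed.

Lemma events_preimage F G (phi : (site -> R) -> site -> R) A :
  (forall z (B : set R), G z -> measurable B -> events F [set eta | B (phi eta z)]) ->
  events G A -> events F [set eta | A (phi eta)].
Proof.
move=> hphi; pose Q A := events F [set eta | A (phi eta)].
apply: (@events_ind G Q); rewrite /Q.
- exact: eventsT.
- move=> _ [s [B [sG mB ->]]] /=.
  by apply: (@events_forall F site [set` s]) => z /= zs; apply: hphi => //; exact: sG.
- by move=> A' _; exact: eventsC.
- by move=> A' _ _; exact: events_bigcup.
Qed.

Lemma events_sub F G A : F `<=` G -> events F A -> events G A.
Proof.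
move=> FG; apply: (events_preimage (phi := id)) => z B Fz mB.
by apply: events_site => //; exact: FG.
Qed.

(** Blindness to the weights outside [F] holds for cylinders and survives
complements and countable unions. *)
Lemma events_local F A eta eta' : events F A ->
  (forall z, F z -> eta z = eta' z) -> A eta -> A eta'.
Proof.
move=> eA eq; suff: A eta <-> A eta' by case.
move: A eA; apply: (@events_ind F [set A | A eta <-> A eta']) => //=.
- move=> _ [s [B [sF mB ->]]] /=.
  split=> h z zs; first by rewrite -eq; [exact: h|exact: sF].
  by rewrite eq; [exact: h|exact: sF].
- by move=> A _ h; split=> nA /h.
- by move=> A _ _ h; split=> -[n _ /h] ?; exists n.
Qed.

Lemma measurable_path_weight (p : seq site) :
  measurable_fun [set: g_sigma_algebraType (cylinders setT)]
    (fun eta : g_sigma_algebraType (cylinders setT) => path_weight eta p).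
Proof.
apply: measurable_sum => z _ B mB; rewrite setTI; exact: events_site.
Qed.

Lemma events_weight_le (p q : seq site) :
  events setT [set eta : site -> R | path_weight eta q <= path_weight eta p].
Proof.
have := measurable_fun_ler (measurable_path_weight q) (measurable_path_weight p).
by move=> /(_ measurableT [set true] _); rewrite setTI; apply.
Qed.

Lemma events_sum F (p : seq site) (C : set R) :
  (forall z, z \in p -> F z) -> measurable C ->
  events F [set eta | C (path_weight eta p)].
Proof.
move=> pF mC.
pose phi eta : site -> R := fun z => if z \in p then eta z else 0.
have eG : events setT [set eta : site -> R | C (path_weight eta p)].
  by have := measurable_path_weight p measurableT mC; rewrite setTI.
have -> : [set eta | C (path_weight eta p)] =
    [set eta | [set eta | C (path_weight eta p)] (phi eta)].
  have E eta : path_weight (phi eta) p = path_weight eta p.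
    by apply: eq_big_seq => z zp; rewrite /phi zp.
  by apply/seteqP; split=> eta /=; rewrite E.
apply: (events_preimage _ eG) => z B _ mB; rewrite /phi.
case zp: (z \in p); first by apply: events_site => //; exact: pF.
have [B0|B0] := pselect (B 0).
  rewrite (_ : [set _ | _] = setT); first exact: eventsT.
  by apply/seteqP; split.
rewrite (_ : [set _ | _] = set0); first exact: events0.
by apply/seteqP; split.
Qed.

End FieldEvents.

(** * Law of the field, independence and exchangeability *)

Section Law.
Variables (R : realType) (d : measure_display) (T : measurableType d).
Variables (P : probability T R) (omega : site -> {RV P >-> R}).
Hypothesis omega_indep : mutually_independent omega.
Hypothesis omega_id : identically_distributed omega.
Hypothesis omega_ge0 : forall z, {ae P, forall w, 0 <= omega z w}.
Implicit Types (F G : set site) (A B : set (site -> R)).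

Definition law A : R := fine (P [set w | A (weights omega w)]).

Lemma field_measurable F A : events F A ->
  measurable [set w | A (weights omega w)].
Proof.
apply: (@events_ind _ F [set A | measurable [set w | A (weights omega w)]]) => /=.
- exact: measurableT.
- move=> _ [s [B [_ mB ->]]].
  rewrite /= [X in measurable X](_ : _ =
      \big[setI/setT]_(z <- s) (omega z @^-1` B z)); last first.
    rewrite -bigcap_seq; apply/seteqP; split=> w /= h z.
      by move=> zs; exact: h.
    by move=> zs; exact: h.
  apply: big_ind => //; first exact: measurableI.
  by move=> z _; rewrite -[X in measurable X]setTI; exact: measurable_funP.
- by move=> A' _; exact: measurableC.
- by move=> A' _ _ mA; 
  exact: (bigcup_measurable (F := fun n => [set w | A' n (weights omega w)])).
Qed.

Lemma lawE A : events setT A -> (law A)%:E = P [set w | A (weights omega w)].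
Proof. by move=> eA; rewrite fineK// fin_num_measure//; exact: field_measurable eA. Qed.

Lemma law_ge0 A : 0 <= law A.
Proof. exact: fine_ge0. Qed.

Lemma lawT : law setT = 1.
Proof. by rewrite /law (_ : [set _ | _] = setT)// probability_setT. Qed.

Lemma law_mono A B : events setT A -> events setT B -> A `<=` B ->
  law A <= law B.
Proof.
move=> eA eB AB; rewrite -lee_fin !lawE//; apply: le_measure; rewrite ?inE.
- exact: field_measurable eA.
- exact: field_measurable eB.
- by move=> w /=; exact: AB.
Qed.

Lemma law_le1 A : events setT A -> law A <= 1.
Proof. by move=> eA; rewrite -lawT; apply: law_mono => //; exact: eventsT. Qed.

Lemma lawUI A B : events setT A -> events setT B ->
  law (A `|` B) + law (A `&` B) = law A + law B.
Proof.
move=> eA eB; apply: EFin_inj; rewrite !EFinD !lawE//; [|exact: eventsI|exact: eventsU].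
have mA := field_measurable eA; have mB := field_measurable eB.
rewrite (_ : [set w | (A `|` B) _] = [set w | A (weights omega w)] `|`
  [set w | B (weights omega w)])// measureUfinr//; last first.
  by rewrite ltey_eq fin_num_measure.
rewrite (_ : [set w | (A `&` B) _] = [set w | A (weights omega w)] `&`
  [set w | B (weights omega w)])// subeK// fin_num_measure//.
exact: measurableI.
Qed.

Lemma lawU_le A B : events setT A -> events setT B ->
  law (A `|` B) <= law A + law B.
Proof. by move=> eA eB; rewrite -lawUI// lerDl law_ge0. Qed.

Lemma law0 : law set0 = 0.
Proof. by rewrite /law (_ : [set _ | _] = set0)// measure0. Qed.

Lemma lawC A : events setT A -> law (~` A) = 1 - law A.
Proof.
move=> eA; have := lawUI eA (eventsC eA).
by rewrite setUv setICr lawT law0 addr0 => ->; rewrite addrC addKr.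
Qed.

Lemma lawDI A B : events setT A -> events setT B ->
  law (~` A `&` B) = law B - law (A `&` B).
Proof.
move=> eA eB; have := lawUI (eventsI (eventsC eA) eB) (eventsI eA eB).
rewrite -setIUl setUC setUv setTI setIACA [X in law (X `&` _)]setIC setICr set0I law0 addr0.
by move=> ->; rewrite addrK.
Qed.

Lemma law_trivIset (A : nat -> set (site -> R)) : (forall n, events setT (A n)) ->
  trivIset setT A -> (law (\bigcup_n A n))%:E = (\sum_(n <oo) (law (A n))%:E)%E.
Proof.
move=> eA tA; rewrite lawE; last exact: events_bigcup.
have -> : [set w | (\bigcup_n A n) (weights omega w)] =
  \bigcup_n [set w | A n (weights omega w)] by [].
rewrite measure_bigcup//=; last 2 first.
- by move=> n _; exact: field_measurable (eA n).
- move=> i j _ _ [w [/= Ai Aj]]; apply: (tA i j) => //.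
  by exists (weights omega w).
transitivity (\sum_(n <oo) P [set w | A n (weights omega w)])%E.
  by apply: eq_eseriesl => n; rewrite in_setT.
by apply: eq_eseriesr => n _; rewrite lawE.
Qed.

Lemma law_cylinder (s : seq site) (B : site -> set R) :
  (forall z, measurable (B z)) ->
  law [set eta | forall z, z \in s -> B z (eta z)] =
  \prod_(z <- undup s) law [set eta | B z (eta z)].
Proof.
move=> mB; apply: EFin_inj.
rewrite lawE; last first.
  by apply: sub_sigma_algebra; exists s, B.
have := omega_indep (undup_uniq s) mB.
rewrite (_ : \bigcap_(i in _) _ =
  [set w | [set eta | forall z, z \in s -> B z (eta z)] (weights omega w)]).
  move=> ->; rewrite -prodEFin; apply: eq_bigr => z _.
  by rewrite lawE//; exact: events_site.
by apply/seteqP; split => w /= h z; have := h z; rewrite /= mem_undup.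
Qed.

Lemma law_site_id z z' (B : set R) : measurable B ->
  law [set eta | B (eta z)] = law [set eta | B (eta z')].
Proof.
by move=> mB; congr fine; exact: (omega_id z z' mB).
Qed.

(** Independence of disjoint regions: the identity passes from cylinders to
all events by Dynkin's theorem, in each of the two arguments in turn. *)
Lemma law_indep F G A B : events F A -> events G B ->
  (forall z, F z -> G z -> False) ->
  law (A `&` B) = law A * law B.
Proof.
move=> eA eB FG.
have subT F' A' : events F' A' -> events setT A' by apply: events_sub.
have step F' B' : events setT B' ->
  (forall A', cylinders F' A' -> law (A' `&` B') = law A' * law B') ->
  forall A', events F' A' -> law (A' `&` B') = law A' * law B'.
  move=> eB' h; apply: (@events_ind _ F'
      [set A' | law (A' `&` B') = law A' * law B']) => //=.
  - by rewrite setTI lawT mul1r.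
  - move=> A' /subT eA' hA'; rewrite lawDI// lawC// hA'; ring.
  - move=> A' eA' tA' hA'; have eA'' n := subT _ _ (eA' n).
    apply: EFin_inj; rewrite setI_bigcupl law_trivIset; last 2 first.
    + by move=> n; exact: eventsI.
    + by move=> i j _ _ [w [[Ai _] [Aj _]]]; apply: (tA' i j) => //; exists w.
    rewrite EFinM law_trivIset// muleC -nneseriesZl; last first.
      by move=> n _; rewrite lee_fin law_ge0.
    by apply: eq_eseriesr => n _; rewrite hA' EFinM muleC.
apply: (step F) => //; first exact: subT eB.
move=> {A eA} A cA; rewrite setIC mulrC; move: B eB.
apply: step; first exact: (subT F _ (@sub_sigma_algebra _ setT (cylinders F) _ cA)).
case: cA => s1 [B1 [s1F mB1 ->]] _ [s2 [B2 [s2F mB2 ->]]].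
pose B z := if z \in s2 then B2 z else B1 z.
have mB z : measurable (B z) by rewrite /B; case: ifP.
have -> : [set eta | forall z, z \in s2 -> B2 z (eta z)] `&`
          [set eta | forall z, z \in s1 -> B1 z (eta z)] =
          [set eta | forall z, z \in undup s2 ++ undup s1 -> B z (eta z)].
  apply/seteqP; split=> eta /=.
    move=> [h2 h1] z; rewrite mem_cat !mem_undup /B.
    by case: ifP => [z2 _|_ /=]; [exact: h2|exact: h1].
  move=> h; split=> z zs; have := h z; rewrite mem_cat !mem_undup /B zs ?orbT.
    by move=> /(_ isT).
  by case: ifP => [z2|_ /(_ isT)//]; exfalso; exact: FG (s1F _ zs) (s2F _ z2).
rewrite !law_cylinder// undup_id; last first.
  rewrite cat_uniq !undup_uniq andbT /=; apply/hasPn => z; rewrite !mem_undup => z1.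
  by apply/negP => z2; exact: FG (s1F _ z1) (s2F _ z2).
rewrite big_cat /=; congr (_ * _); apply: eq_big_seq => z; rewrite mem_undup /B => zs.
  by rewrite zs.
by case: ifP => // z2; exfalso; exact: FG (s1F _ zs) (s2F _ z2).
Qed.

(** Exchangeability. Translations, the reflection in the diagonal and swaps of
two sites are all relabellings. *)
Lemma law_relabel (f g : site -> site) A : cancel f g -> events setT A ->
  law [set eta : site -> R | A (eta \o f)] = law A.
Proof.
move=> fK; have ef A' : events setT A' -> events setT [set eta : site -> R | A' (eta \o f)].
  by apply: events_preimage => z B _; exact: events_site.
move: A; apply: (@events_ind _ setT
  [set A | law [set eta : site -> R | A (eta \o f)] = law A]) => //=.
- move=> _ [s [B [_ mB ->]]] /=.
  rewrite (_ : [set eta | _] = [set eta | forall z, z \in map f s ->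
      B (g z) (eta z)]); last first.
    apply/seteqP; split=> eta /= h.
      by move=> z /mapP[y ys ->]; rewrite fK; exact: h.
    by move=> z zs; have := h (f z); rewrite fK; apply; exact: map_f.
  rewrite law_cylinder// (@law_cylinder _ (B \o g) (fun z => mB (g z))).
  rewrite undup_map_inj; last exact: can_inj fK.
  rewrite big_map; apply: eq_bigr => z _; rewrite /= fK; exact: law_site_id.
- move=> A eA hA.
  by rewrite (lawC eA) -hA -(lawC (ef _ eA)).
- move=> A eA tA hA; apply: EFin_inj.
  rewrite law_trivIset//.
  rewrite (_ : [set eta | _] = \bigcup_n [set eta : site -> R | A n (eta \o f)])//.
  rewrite law_trivIset//.
  + by apply: eq_eseriesr => n _; rewrite hA.
  + by move=> n; exact: ef.
  + move=> i j _ _ [eta [Ai Aj]]; apply: (tA i j) => //.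
    by exists (eta \o f).
Qed.

End Law.

(** * The Harris inequality *)

Section Harris.
Variables (R : realType) (d : measure_display) (T : measurableType d).
Variables (P : probability T R) (omega : site -> {RV P >-> R}).
Hypothesis omega_indep : mutually_independent omega.
Hypothesis omega_id : identically_distributed omega.
Hypothesis omega_ge0 : forall z, {ae P, forall w, 0 <= omega z w}.
Implicit Types (F G : set site) (A B : set (site -> R)).
Local Notation law := (law omega).

Definition nonneg : set (site -> R) := [set eta | forall z, 0 <= eta z].

Lemma events_nonneg : events setT nonneg.
Proof.
rewrite (_ : nonneg = [set eta | forall z, setT z -> 0 <= eta z]).
  apply: events_forall => z _.
  rewrite [X in events _ X](_ : _ = [set eta | `[0, +oo[%classic (eta z)]).
    exact: events_site.
  by apply/seteqP; split=> eta /=; rewrite in_itv/= andbT.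
by apply/seteqP; split=> eta /=; [move=> h z _; exact: h|move=> h z; exact: h].
Qed.

Lemma law_ae A : events setT A -> {ae P, forall w, A (weights omega w)} ->
  law A = 1.
Proof.
move=> eA hA; apply/eqP; rewrite eq_sym -subr_eq0 -(lawC omega eA); apply/eqP.
apply: EFin_inj; rewrite lawE; last exact: eventsC.
apply: (negligibleP _ _).1 => //.
exact: field_measurable (eventsC eA).
Qed.

Lemma law_nonneg : law nonneg = 1.
Proof.
apply: law_ae; first exact: events_nonneg.
pose Q n w := if unpickle n is Some z then 0 <= omega z w else true.
have h n : {ae P, forall w, Q n w}.
  rewrite /Q; case: (unpickle n) => [z|]; [exact: omega_ge0|exact: aeW].
have := ae_foralln h; apply: filterS => w hw z.
by have := hw (pickle z); rewrite /Q pickleK.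
Qed.

Lemma law_mono_nonneg A B : events setT A -> events setT B ->
  (forall eta, nonneg eta -> A eta -> B eta) -> law A <= law B.
Proof.
move=> eA eB AB; have eN := events_nonneg; have eN' := eventsC eN.
apply: (@le_trans _ _ (law (B `|` ~` nonneg))).
  apply: law_mono => //; first exact: eventsU.
  move=> eta Aeta; have [N|N] := pselect (nonneg eta); last by right.
  by left; exact: AB.
rewrite (le_trans (lawU_le omega eB eN'))// lawC// law_nonneg subrr addr0//.
Qed.

Lemma law_indep_seq (I : eqType) (s : seq I) (F : I -> set site)
    (A : I -> set (site -> R)) :
  uniq s -> (forall i, events (F i) (A i)) ->
  (forall i j z, F i z -> F j z -> i = j) ->
  law [set eta | forall i, i \in s -> A i eta] = \prod_(i <- s) law (A i).
Proof.
move=> + eA dF; elim: s => [_|i s IH /= /andP[is_ us]].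
  by rewrite big_nil (_ : [set _ | _] = setT) ?lawT//; apply/seteqP; split.
rewrite big_cons -IH// -(@law_indep _ _ _ P omega omega_indep (F i)
  [set z | exists2 j, j \in s & F j z])//.
- congr (law _); apply/seteqP; split=> eta /=.
    move=> h; split; first by apply: h; rewrite mem_head.
    by move=> j js; apply: h; rewrite inE js orbT.
  by move=> [h1 h2] j; rewrite inE => /orP[/eqP->//|]; exact: h2.
- elim: s {IH is_ us} => [|j s IH].
    rewrite [X in events _ X](_ : _ = setT); first exact: eventsT.
    by apply/seteqP; split.
  rewrite [X in events _ X](_ : _ =
      A j `&` [set eta | forall i, i \in s -> A i eta]); last first.
    apply/seteqP; split=> eta /=.
      move=> h; split; first by apply: h; rewrite mem_head.
      by move=> k ks; apply: h; rewrite inE ks orbT.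
    by move=> [h1 h2] k; rewrite inE => /orP[/eqP->//|]; exact: h2.
  apply: eventsI.
    by apply: (events_sub _ (eA j)) => z Fz; exists j; rewrite ?mem_head.
  apply: (events_sub _ IH) => z [k ks Fz].
  by exists k; rewrite // inE ks orbT.
- move=> z Fi [j js Fj]; move: is_; rewrite (dF _ _ _ Fi Fj) js//.
Qed.

Definition decreasing_at (z : site) A := forall eta eta' : site -> R,
  (forall y, y != z -> eta' y = eta y) -> eta' z <= eta z -> A eta -> A eta'.

Definition swap_sites (a b z : site) : site :=
  if z == a then b else if z == b then a else z.

Lemma swap_sitesK a b : involutive (swap_sites a b).
Proof.
move=> z; rewrite /swap_sites; have [->|za] := eqVneq z a.
  by rewrite eqxx; case: eqVneq => // ->.
have [->|zb] := eqVneq z b; first by rewrite eqxx.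
by rewrite (negbTE za) (negbTE zb).
Qed.

Lemma fresh_site (s : seq site) : exists z, z \notin s.
Proof.
exists (Posz (\sum_(y <- s) `|y.1|%N).+1, 0); apply/negP => zs.
suff : (`|(Posz (\sum_(y <- s) `|y.1|%N).+1, 0 : int).1| <=
        \sum_(y <- s) `|y.1|)%N by rewrite /= ltnn.
move: zs; move: (Posz _, _) => z; elim: s => // y s IH.
rewrite inE big_cons => /orP[/eqP->|/IH h]; first exact: leq_addr.
exact: leq_trans h (leq_addl _ _).
Qed.

Lemma decreasing_at_swap F A z z' eta : events F A -> ~ F z' ->
  decreasing_at z A -> eta z' <= eta z -> A eta ->
  A (eta \o swap_sites z z').
Proof.
move=> eA Fz' dA le Aeta.
have : A (fun y => if y == z then eta z' else eta y).
  apply: dA Aeta; first by move=> y /negbTE ->.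
  by rewrite eqxx.
apply: events_local eA _ => y Fy /=; rewrite /swap_sites.
case: eqP => // _; case: eqP => // yz'.
by move: Fz'; rewrite -yz'.
Qed.

(** One resampling step. With [z'] a fresh site, the swapped events are copies
of [U] and [D] in which the weight at [z] is replaced by an independent one;
ordering the weights at [z] and [z'] orders both pairs of events in the same
direction, and exchangeability turns this into an inequality of
probabilities. *)
Lemma law_swap_le F G U D z z' : events F U -> events G D ->
  ~ F z' -> ~ G z' -> decreasing_at z U -> decreasing_at z D ->
  law (U `&` [set eta : site -> R | D (eta \o swap_sites z z')]) <= law (U `&` D).
Proof.
move=> eU eD Fz' Gz' dU dD; set f := swap_sites z z'.
have fK : cancel f f by exact: swap_sitesK.
have fKE (eta : site -> R) : eta \o f \o f = eta.
  by apply/funext => y /=; rewrite fK.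
pose sw A := [set eta : site -> R | A (eta \o f)].
have esw A : events setT A -> events setT (sw A).
  by apply: events_preimage => y B _; exact: events_site.
have lsw A : events setT A -> law (sw A) = law A.
  exact: (law_relabel omega_indep omega_id fK).
have eU' : events setT U by exact: events_sub eU.
have eD' : events setT D by exact: events_sub eD.
have eqd : law (sw U `&` sw D) = law (U `&` D).
  by rewrite -(lsw (U `&` D))//; exact: eventsI.
have eqs : law (sw U `&` D) = law (U `&` sw D).
  rewrite -(lsw (U `&` sw D)); last by apply: eventsI => //; exact: esw.
  by congr (law _); apply/seteqP; split=> eta; rewrite /sw /= fKE.
have key : law (U `&` sw D) + law (sw U `&` D) <=
           law (U `&` D) + law (sw U `&` sw D).
  rewrite -lawUI; [|by apply: eventsI => //; exact: esw..].
  rewrite -(lawUI _ (eventsI eU' eD')); last by apply: eventsI; exact: esw.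
  rewrite setIACA [in leRHS]setIACA [sw D `&` D]setIC lerD2r.
  apply: law_mono.
  - by apply: eventsU; apply: eventsI => //; exact: esw.
  - by apply: eventsU; apply: eventsI => //; exact: esw.
  move=> eta; have [le|/ltW ge] := leP (eta z') (eta z).
    have h1 := decreasing_at_swap eU Fz' dU le.
    have h2 := decreasing_at_swap eD Gz' dD le.
    by move=> [[u v']|[u' v]]; right; split => //=; [exact: h1|exact: h2].
  have le' : (eta \o f) z' <= (eta \o f) z.
    rewrite /f /= /swap_sites !eqxx; case: eqP => // ->; exact: lexx.
  have h1 := decreasing_at_swap eU Fz' dU le'.
  have h2 := decreasing_at_swap eD Gz' dD le'.
  rewrite -/f fKE in h1 h2.
  by move=> [[u v']|[u' v]]; left; split => //=; [exact: h2|exact: h1].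
by move: key; rewrite eqs eqd; lra.
Qed.

(** The Harris inequality. The sites that two decreasing events have in common
are replaced one at a time, in the second event, by fresh sites, until the two
events are independent; no step increases the probability of the
intersection. *)
Lemma harris (F G : seq site) U D :
  events [set` F] U -> events [set` G] D ->
  (forall z, z \in F -> z \in G -> decreasing_at z U) ->
  (forall z, decreasing_at z D) ->
  law U * law D <= law (U `&` D).
Proof.
move=> eU; have [s] : exists s : seq site,
    forall z, z \in F -> z \in G -> z \in s by exists F.
elim: s G D => [|z s IH] G D sG eD dU dD.
  rewrite (law_indep omega_indep eU eD)// => z /= zF zG.
  by have := sG z zF zG.
have [/andP[zF zG]|zFG] := boolP ((z \in F) && (z \in G)); last first.
  apply: (IH G) => // y yF yG; have := sG y yF yG; rewrite inE => /orP[/eqP yz|//].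
  by move: zFG; rewrite -yz yF yG.
have [z'] := fresh_site (F ++ G); rewrite mem_cat negb_or => /andP[z'F z'G].
set f := swap_sites z z'; have fK : cancel f f by exact: swap_sitesK.
have eD' : events setT D by exact: events_sub eD.
rewrite -(law_relabel omega_indep omega_id fK eD').
apply: (@le_trans _ _ (law (U `&` [set eta : site -> R | D (eta \o f)]))); last first.
  apply: law_swap_le eU eD _ _ _ _ => //.
  - exact/negP.
  - exact/negP.
  - exact: dU.
have memf y : y \in map f G = (f y \in G).
  by rewrite -[y in LHS]fK mem_map//; exact: can_inj fK.
have GF y : y \in F -> y \in map f G -> (y \in G) && (y != z).
  rewrite memf /f /swap_sites; case: eqP => [->|yz] yF; first by rewrite (negbTE z'G).
  case: eqP => [yz'|_ ->//]; by move: z'F; rewrite -yz' yF.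
apply: (IH (map f G)).
- move=> y yF /(GF _ yF)/andP[yG yz]; have := sG y yF yG.
  by rewrite inE (negbTE yz).
- apply: events_preimage eD => y B yG mB /=.
  apply: (events_site (F := [set` map f G])) => //=; exact: map_f.
- by move=> y yF /(GF _ yF)/andP[yG _]; exact: dU.
- move=> y eta eta' h1 h2 /=; apply: (dD (f y)) => /=; last by rewrite fK.
  by move=> x xy; apply: h1; apply: contraNneq xy => <-; rewrite fK.
Qed.

(** Iterating: intersecting a decreasing event with another keeps it
decreasing. *)
Lemma harris_seq (F G : seq site) U (s : seq (set (site -> R))) (c : R) :
  0 <= c -> {subset G <= F} ->
  events [set` F] U -> (forall z, z \in G -> decreasing_at z U) ->
  (forall D, D \in s -> [/\ events [set` G] D, forall z, decreasing_at z D &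
     c <= law D]) ->
  law U * c ^+ size s <= law (U `&` [set eta | forall D, D \in s -> D eta]).
Proof.
move=> c0 GF; elim: s U => [|D s IH] U eU dU hs.
  rewrite expr0 mulr1; rewrite (_ : _ `&` _ = U)//.
  by apply/seteqP; split=> eta /= => [[]|].
have [eD dD cD] := hs D (mem_head _ _).
have eDF : events [set` F] D by apply: events_sub eD => z; exact: GF.
rewrite exprS mulrA (@le_trans _ _ (law (U `&` D) * c ^+ size s))//.
  rewrite ler_wpM2r ?exprn_ge0// (le_trans _ (harris eU eD _ dD))//.
    by rewrite ler_wpM2l// law_ge0.
  by move=> z _; exact: dU.
apply: le_trans (IH (U `&` D) (eventsI eU eDF) _ _) _.
- move=> z zG eta eta' h1 h2 [h3 h4].
  by split; [exact: (dU z) h3|exact: (dD z) h4].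
- by move=> D' D's; apply: hs; rewrite inE D's orbT.
rewrite le_eqVlt; apply/orP; left; apply/eqP; congr (law _).
apply/seteqP; split=> eta /=.
  by move=> [[u v'] h]; split=> // D'; rewrite inE => /orP[/eqP->//|]; exact: h.
move=> [u h]; split; last by move=> D' D's; apply: h; rewrite inE D's orbT.
by split=> //; apply: h; rewrite mem_head.
Qed.

End Harris.

(** * Up-right paths and passage values *)

Definition level (z : site) : int := z.1 + z.2.

Definition le_site (u v : site) : bool := (u.1 <= v.1) && (u.2 <= v.2).

Lemma le_site_trans v u w : le_site u v -> le_site v w -> le_site u w.
Proof.
move=> /andP[h1 h2] /andP[h3 h4].
by apply/andP; split; [exact: le_trans h1 h3|exact: le_trans h2 h4].
Qed.

Lemma level_path u p : path up_right_step u p ->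
  level (last u p) = level u + (size p)%:Z.
Proof.
elim: p u => [|z p IH] u /=; first by move=> _; rewrite addr0.
move=> /andP[uz /IH->]; rewrite intS; move: uz.
by rewrite /up_right_step /level => /orP[/eqP->|/eqP->] /=; lia.
Qed.

Lemma size_up_right_path u v p : up_right_path u v p ->
  (size p)%:Z = level v - level u.
Proof. by move=> /andP[/level_path + /eqP <-] => ->; rewrite addrC addKr. Qed.

Lemma path_le_last u p : path up_right_step u p -> le_site u (last u p).
Proof.
elim: p u => [|z p IH] u /=; first by rewrite /le_site !lexx.
move=> /andP[uz /IH]; move: uz.
by rewrite /up_right_step /le_site => /orP[/eqP->|/eqP->] /=; lia.
Qed.

Lemma mem_up_right_path u v p z : up_right_path u v p -> z \in p ->
  [&& le_site u z, le_site z v & level u < level z].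
Proof.
elim: p u => [//|y p IH] u /=; rewrite /up_right_path /= => /andP[/andP[uy yp] /eqP yv].
have yv' : le_site y v by rewrite -yv; exact: path_le_last.
rewrite inE => /orP[/eqP zy|zp].
  rewrite {}zy yv'; move: uy; rewrite /up_right_step /le_site /level.
  by move=> /orP[/eqP->|/eqP->] /=; lia.
have /and3P[h1 h2 h3] : [&& le_site y z, le_site z v & level y < level z].
  by apply: IH => //; rewrite /up_right_path yp yv eqxx.
rewrite h2; move: uy h1 h3; rewrite /up_right_step /le_site /level.
by move=> /orP[/eqP->|/eqP->] /=; lia.
Qed.

Lemma up_right_path_cat u v w p q : up_right_path u v p ->
  up_right_path v w q -> up_right_path u w (p ++ q).
Proof.
rewrite /up_right_path cat_path last_cat.
by move=> /andP[-> /eqP ->] /andP[-> ->].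
Qed.

Lemma up_right_path_catE u w p q : up_right_path u w (p ++ q) =
  up_right_path u (last u p) p && up_right_path (last u p) w q.
Proof. by rewrite /up_right_path cat_path last_cat eqxx andbT andbA. Qed.

Lemma up_right_path_le u v p : up_right_path u v p -> le_site u v.
Proof. by move=> /andP[/path_le_last + /eqP <-]. Qed.

Lemma up_right_path_exists u v : le_site u v -> exists p, up_right_path u v p.
Proof.
move=> uv; have [n] : exists n : nat, level v - level u = n%:Z.
  by exists (absz (level v - level u)); move: uv; rewrite /le_site /level; lia.
elim: n u uv => [|n IH] u uv nE.
  exists [::]; rewrite /up_right_path /=; apply/eqP.
  move: u v uv nE => [u1 u2] [v1 v2]; rewrite /le_site /level /= => uv nE.
  by congr pair; lia.
have [u1v|vu1] := ltP u.1 v.1.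
  have [||p /andP[pp pv]] := IH (u.1 + 1, u.2).
  - by move: uv u1v; rewrite /le_site /=; lia.
  - by move: nE; rewrite /level /=; lia.
  by exists ((u.1 + 1, u.2) :: p); rewrite /up_right_path /= /up_right_step eqxx pp.
have [||p /andP[pp pv]] := IH (u.1, u.2 + 1).
- by move: uv vu1 nE; rewrite /le_site /level /=; lia.
- by move: nE; rewrite /level /=; lia.
by exists ((u.1, u.2 + 1) :: p); rewrite /up_right_path /= /up_right_step eqxx orbT pp.
Qed.

Definition shift (a z : site) : site := (z.1 + a.1, z.2 + a.2).
Definition flip (z : site) : site := (z.2, z.1).

Lemma up_right_path_shift a u v p : up_right_path u v p ->
  up_right_path (shift a u) (shift a v) (map (shift a) p).
Proof.
rewrite /up_right_path last_map => /andP[pp /eqP ->]; rewrite eqxx andbT.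
elim: p u pp => //= z p IH u /andP[uz /IH ->]; rewrite andbT.
move: uz; rewrite /up_right_step /shift.
by move=> /orP[/eqP->|/eqP->] /=; apply/orP; [left|right]; apply/eqP; congr pair; lia.
Qed.

Lemma up_right_path_flip u v p : up_right_path u v p ->
  up_right_path (flip u) (flip v) (map flip p).
Proof.
rewrite /up_right_path last_map => /andP[pp /eqP ->]; rewrite eqxx andbT.
elim: p u pp => //= z p IH u /andP[uz /IH ->]; rewrite andbT.
move: uz; rewrite /up_right_step /flip.
by move=> /orP[/eqP->|/eqP->] /=; rewrite eqxx ?orbT.
Qed.

Fixpoint paths_from (n : nat) (u : site) : seq (seq site) :=
  if n is n'.+1 then
    [seq (u.1 + 1, u.2) :: p | p <- paths_from n' (u.1 + 1, u.2)] ++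
    [seq (u.1, u.2 + 1) :: p | p <- paths_from n' (u.1, u.2 + 1)]
  else [:: [::]].

Lemma mem_paths_from n u p :
  (p \in paths_from n u) = (size p == n) && path up_right_step u p.
Proof.
elim: n u p => [|n IH] u p /=.
  by rewrite inE; case: p.
rewrite mem_cat; case: p => [|z p].
  by apply/negbTE; rewrite negb_or; apply/andP; split; apply/mapP => -[].
rewrite /= eqSS; apply/orP/andP.
  case=> /mapP[q]; rewrite IH => /andP[/eqP sq pq] [-> ->];
  by rewrite sq eqxx /up_right_step eqxx ?orbT pq.
move=> [/eqP sp /andP[/orP[/eqP zE|/eqP zE] pp]]; [left|right];
by apply/mapP; exists p; rewrite ?zE// IH sp eqxx -zE.
Qed.

Lemma mem_paths_from_up_right n u v p : up_right_path u v p ->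
  level v - level u = n%:Z -> p \in paths_from n u.
Proof.
move=> pp nE; rewrite mem_paths_from; move/andP: (pp) => [-> _]; rewrite andbT.
by have := size_up_right_path pp; rewrite nE => -[->].
Qed.

Section Weights.
Variable R : realType.
Implicit Types eta : site -> R.

Lemma path_weight_cat eta p q :
  path_weight eta (p ++ q) = path_weight eta p + path_weight eta q.
Proof. by rewrite /path_weight big_cat. Qed.

Lemma path_weight_ge0 eta p : (forall z, 0 <= eta z) -> 0 <= path_weight eta p.
Proof. by move=> h; apply: sumr_ge0. Qed.

Lemma path_weight_map eta f p :
  path_weight eta (map f p) = path_weight (eta \o f) p.
Proof. by rewrite /path_weight big_map. Qed.

Lemma seq_argmax (I : eqType) (f : I -> R) (s : seq I) : s != [::] ->
  exists2 i, i \in s & forall j, j \in s -> f j <= f i.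
Proof.
elim: s => // i s IH _; have [->|/IH[k ks hk]] := eqVneq s [::].
  by exists i; rewrite ?mem_head// => j; rewrite inE => /eqP->.
have [ik|ki] := leP (f i) (f k).
  by exists k; rewrite ?inE ?ks ?orbT// => j /orP[/eqP->|/hk].
exists i; rewrite ?mem_head// => j; rewrite inE => /orP[/eqP->//|/hk].
by move/le_trans; apply; exact: ltW.
Qed.

(** The event that the passage value is at least [x], phrased with a witness so
that concatenation and translation act on paths and extended reals stay out
of the way; [reachP] links it to [lpp]. *)
Definition reach (u v : site) (x : R) : set (site -> R) :=
  [set eta | exists2 p, up_right_path u v p & x <= path_weight eta p].

(** There are finitely many paths, so the supremum defining [lpp] is attained. *)
Lemma reachP eta u v x : reach u v x eta <-> (x%:E <= lpp eta u v)%E.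
Proof.
split=> [[p pp xp]|].
  apply: (@le_trans _ _ (path_weight eta p)%:E); first by rewrite lee_fin.
  by apply: ereal_sup_ubound; exists p.
have [[p0 pp0]|np] := pselect (exists p, up_right_path u v p); last first.
  rewrite /lpp (_ : [set _ | _ in _] = set0) ?ereal_sup0 ?leNgt ?ltNyr//.
  by apply/seteqP; split=> // y [p pp _]; exfalso; apply: np; exists p.
pose s := [seq p <- paths_from (size p0) u | last u p == v].
have sE p : up_right_path u v p -> p \in s.
  move=> pp; rewrite mem_filter; case/andP: (pp) => _ ->.
  rewrite (mem_paths_from_up_right pp)//.
  by rewrite -(size_up_right_path pp0).
have [|p ps hp] := @seq_argmax _ (path_weight eta) s.
  by apply/eqP => s0; have := sE _ pp0; rewrite s0.
move=> xl; exists p.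
  by move: ps; rewrite mem_filter mem_paths_from /up_right_path => /and3P[-> _ ->].
rewrite -lee_fin (le_trans xl)//; apply: ge_ereal_sup => _ [q qp <-].
by rewrite lee_fin hp// sE.
Qed.

Lemma events_reach F u v x :
  (forall z, le_site u z -> le_site z v -> level u < level z -> F z) ->
  events F (reach u v x).
Proof.
move=> hF; apply: (events_exists (D := [set p | up_right_path u v p])) => p pp.
rewrite [X in events _ X](_ : _ =
    [set eta | `[x, +oo[%classic (path_weight eta p)]).
  apply: events_sum => // z zp; have /and3P[? ? ?] := mem_up_right_path pp zp.
  exact: hF.
by apply/seteqP; split=> eta /=; rewrite in_itv/= andbT.
Qed.

Lemma reach_ge u v x y : x <= y -> reach u v y `<=` reach u v x.
Proof. by move=> xy eta [p pp yp]; exists p => //; exact: le_trans yp. Qed.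

Lemma reach_cat eta u v w x y : reach u v x eta -> reach v w y eta ->
  reach u w (x + y) eta.
Proof.
move=> [p pp xp] [q qq yq]; exists (p ++ q); first exact: up_right_path_cat qq.
by rewrite path_weight_cat lerD.
Qed.

Lemma reach_nonneg eta u v x : (forall z, 0 <= eta z) -> le_site u v ->
  x <= 0 -> reach u v x eta.
Proof.
move=> h /up_right_path_exists[p pp] x0; exists p => //.
exact: le_trans x0 (path_weight_ge0 _ h).
Qed.

Lemma reach_widen eta u v u' v' x : (forall z, 0 <= eta z) ->
  le_site u' u -> le_site v v' -> reach u v x eta -> reach u' v' x eta.
Proof.
move=> h uu vv r; rewrite -[x]addr0 -[x]add0r.
apply: (reach_cat (v := v)); last exact: reach_nonneg.
by apply: reach_cat r; exact: reach_nonneg.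
Qed.

Lemma reach_shift a eta u v x :
  reach (shift a u) (shift a v) x eta <-> reach u v x (eta \o shift a).
Proof.
split=> [[p pp xp]|[p pp xp]].
  have aK z : shift (- a.1, - a.2) (shift a z) = z.
    by case: z => z1 z2; rewrite /shift /=; congr pair; lia.
  have aK' z : shift a (shift (- a.1, - a.2) z) = z.
    by case: z => z1 z2; rewrite /shift /=; congr pair; lia.
  exists (map (shift (- a.1, - a.2)) p).
    by rewrite -[u]aK -[v]aK; exact: up_right_path_shift.
  rewrite path_weight_map (le_trans xp)// le_eqVlt; apply/orP; left; apply/eqP.
  by apply: eq_bigr => z _ /=; rewrite aK'.
exists (map (shift a) p); first exact: up_right_path_shift.
by rewrite path_weight_map.
Qed.

Lemma reach_flip eta u v x :
  reach (flip u) (flip v) x eta <-> reach u v x (eta \o flip).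
Proof.
have fK z : flip (flip z) = z by case: z.
split=> [[p pp xp]|[p pp xp]].
  exists (map flip p); first by rewrite -[u]fK -[v]fK; exact: up_right_path_flip.
  rewrite path_weight_map (le_trans xp)// le_eqVlt; apply/orP; left; apply/eqP.
  by apply: eq_bigr => z _ /=; rewrite fK.
by exists (map flip p); [exact: up_right_path_flip|rewrite path_weight_map].
Qed.

Lemma floor_half h (k : int) :
  (Num.floor (h.*2%:R / 2 + k%:~R : R), Num.floor (h.*2%:R / 2 - k%:~R : R)) =
  (h%:Z + k, h%:Z - k).
Proof.
have -> : h.*2%:R / 2 = (h%:Z)%:~R :> R.
  by rewrite -muln2 natrM mulfK ?pnatr_eq0//.
by rewrite -intrD -intrB !intrKfloor.
Qed.

(** For even [n] the integer points on which the line value is defined exhaust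
the lattice points of the line, so the extended supremum is a maximum over
all paths with [n] steps. *)
Lemma line_geodesicP eta n p : ~~ odd n -> line_geodesic eta n p <->
  [/\ path up_right_step (0, 0) p, size p = n &
    forall q, path up_right_step (0, 0) q -> size q = n ->
      path_weight eta q <= path_weight eta p].
Proof.
move=> /negbTE n2; have nE : n = n./2.*2 by rewrite -[LHS]odd_double_half n2.
set h := n./2 in nE.
have to_line q : path up_right_step (0, 0) q -> size q = n ->
    ((path_weight eta q)%:E <= lpp_line eta n)%E.
  move=> qq sq; pose k : int := (last (0, 0) q).1 - h%:Z.
  apply: (@le_trans _ _ (lpp eta (0, 0) (last (0, 0) q))).
    by apply/reachP; exists q => //; rewrite /up_right_path qq eqxx.
  apply: ereal_sup_ubound; exists k => //=; rewrite {1 2}nE floor_half.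
  congr lpp; have := level_path qq; rewrite sq /k /level.
  by case: (last _ _) => v1 v2 /= E; congr pair; lia.
have of_line x : (forall q, path up_right_step (0, 0) q -> size q = n ->
    path_weight eta q <= x) -> (lpp_line eta n <= x%:E)%E.
  move=> hx; apply: ge_ereal_sup => _ [k _ <-].
  rewrite {1 2}nE floor_half; apply: ge_ereal_sup => _ [q /= qq <-].
  rewrite lee_fin; apply: hx; first by case/andP: qq.
  by have := size_up_right_path qq; rewrite /level /=; lia.
split=> [[v [vn pp pE]]|[pp sp hp]].
  have sp : size p = n by have := size_up_right_path pp; rewrite /level /=; lia.
  split=> //; first by case/andP: pp.
  by move=> q qq sq; rewrite -lee_fin pE; exact: to_line.
exists (last (0, 0) p); split.
- by have := level_path pp; rewrite sp /level /=; lia.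
- by rewrite /up_right_path pp eqxx.
- by apply/eqP; rewrite eq_le to_line//=; exact: of_line.
Qed.

Lemma line_geodesic_exists eta n : ~~ odd n -> exists p, line_geodesic eta n p.
Proof.
move=> n2; have [|p ps hp] := @seq_argmax _ (path_weight eta) (paths_from n (0, 0)).
  have [|p pp] := @up_right_path_exists (0, 0) (n%:Z, 0).
    by rewrite /le_site /=; lia.
  apply/eqP => s0; have := mem_paths_from_up_right (n := n) pp.
  by rewrite s0 /level /= => /(_ _)/negP; apply => //; lia.
exists p; apply/line_geodesicP => //.
move: ps; rewrite mem_paths_from => /andP[/eqP sp pp]; split=> // q qq sq.
by apply: hp; rewrite mem_paths_from sq eqxx.
Qed.

Lemma line_endpointP eta n : ~~ odd n -> exists p,
  [/\ up_right_path (0, 0) (line_endpoint eta n) p, size p = n &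
    forall q, path up_right_step (0, 0) q -> size q = n ->
      path_weight eta q <= path_weight eta p].
Proof.
move=> n2; rewrite /line_endpoint; case: xgetP => [p _|].
  move=> /(line_geodesicP _ _ n2)[pp sp hp]; exists p; split=> //.
  by rewrite /up_right_path pp eqxx.
by have [p gp] := line_geodesic_exists eta n2 => /(_ p).
Qed.

End Weights.

(** * Tail probabilities of passage values *)

Section Passage.
Variables (R : realType) (d : measure_display) (T : measurableType d).
Variables (P : probability T R) (omega : site -> {RV P >-> R}).
Hypothesis omega_indep : mutually_independent omega.
Hypothesis omega_id : identically_distributed omega.
Hypothesis omega_ge0 : forall z, {ae P, forall w, 0 <= omega z w}.
Hypothesis omega_unbounded : forall z (beta : R),
  (0 < P [set w | (beta < omega z w)%R])%E.
Local Notation law := (law omega).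
Implicit Types (u v : site) (x y r : R).

Definition pass v x : R := law (reach (0, 0) v x).

Lemma events_reachT u v x : events setT (@reach R u v x).
Proof. exact: events_reach. Qed.
Hint Resolve events_reachT : core.

Lemma pass_ge0 v x : 0 <= pass v x. Proof. exact: law_ge0. Qed.

Lemma pass_le1 v x : pass v x <= 1. Proof. exact: law_le1. Qed.

Lemma law_reach_shift u v x : law (reach u (shift u v) x) = pass v x.
Proof.
have uK : cancel (shift u) (shift (- u.1, - u.2)).
  by case=> z1 z2; rewrite /shift /=; congr pair; lia.
rewrite /pass -[RHS](law_relabel omega_indep omega_id uK)//; congr (law _).
have {1}-> : u = shift u (0, 0) by case: u {uK} => u1 u2; rewrite /shift /= !add0r.
by apply/seteqP; split=> eta /reach_shift.
Qed.

Lemma pass_flip v x : pass (flip v) x = pass v x.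
Proof.
have fK : cancel flip flip by case.
rewrite /pass -[RHS](law_relabel omega_indep omega_id fK)//; congr (law _).
by apply/seteqP; split=> eta => [/(reach_flip _ (0, 0))|h]//; exact/(reach_flip _ (0, 0)).
Qed.

Lemma pass_widen u v x : le_site u v -> pass u x <= pass v x.
Proof.
move=> uv; apply: (law_mono_nonneg omega_ge0) => // eta h.
exact: reach_widen.
Qed.

Lemma pass_ge v x y : x <= y -> pass v y <= pass v x.
Proof. by move=> xy; apply: law_mono => //; exact: reach_ge. Qed.

(** Superadditivity: a path to [u] followed by a path from [u] uses disjoint
sets of weights. *)
Lemma pass_super u v x y : pass u x * pass v y <= pass (shift u v) (x + y).
Proof.
rewrite -(law_reach_shift u v).
rewrite -(@law_indep _ _ _ P _ omega_indep [set z | level z <= level u]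
  [set z | level u < level z]).
- apply: law_mono => //; first exact: eventsI.
  by move=> eta [h1 h2]; exact: reach_cat h2.
- by apply: events_reach => z _; rewrite /le_site /level /=; lia.
- exact: events_reach.
- by move=> z /=; rewrite ltNge => ->.
Qed.

Definition scale_site (n : nat) (v : site) : site := (n%:Z * v.1, n%:Z * v.2).

Lemma pass00 : pass (0, 0) 0 = 1.
Proof.
rewrite /pass (_ : reach _ _ _ = setT) ?lawT//; apply/seteqP; split=> eta // _.
by exists [::]; rewrite /path_weight ?big_nil.
Qed.

Lemma pass_scale n v x : pass v x ^+ n <= pass (scale_site n v) (n%:R * x).
Proof.
elim: n => [|n IH]; first by rewrite /scale_site !mul0r expr0 pass00.
rewrite exprSr; apply: (@le_trans _ _
  (pass (scale_site n v) (n%:R * x) * pass v x)).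
  by rewrite ler_wpM2r ?pass_ge0.
apply: (le_trans (pass_super _ _ _ _)); rewrite le_eqVlt; apply/orP; left; apply/eqP.
congr pass; last by rewrite -natr1 mulrDl mul1r.
by rewrite /shift /scale_site /=; congr pair; lia.
Qed.

(** Combining copies of a vector with copies of its mirror image: the resulting
direction can be any direction closer to the diagonal than the original. *)
Lemma pass_mix a b v w x :
  le_site (shift (scale_site a v) (scale_site b (flip v))) w ->
  pass v x ^+ (a + b) <= pass w ((a + b)%:R * x).
Proof.
move=> h; apply: le_trans (pass_widen _ h).
rewrite exprD natrD mulrDl; apply: le_trans (pass_super _ _ _ _).
apply: ler_pM; rewrite ?exprn_ge0 ?pass_ge0//; first exact: pass_scale.
by rewrite -pass_flip; exact: pass_scale.
Qed.

Definition tail_prob (b : R) : R := law [set eta | b < eta (0, 0)].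

Lemma events_gt F z (b : R) : F z -> events F [set eta : site -> R | b < eta z].
Proof.
move=> Fz; rewrite [X in events _ X](_ : _ = [set eta | `]b, +oo[%classic (eta z)]).
  exact: events_site.
by apply/seteqP; split=> eta /=; rewrite in_itv/= andbT.
Qed.

Lemma tail_prob_gt0 b : 0 < tail_prob b.
Proof.
rewrite -lte_fin lawE; last exact: events_gt.
exact: omega_unbounded.
Qed.

Lemma tail_prob_le1 b : tail_prob b <= 1.
Proof. by apply: law_le1; exact: events_gt. Qed.

Lemma law_all_gt (p : seq site) (b : R) :
  tail_prob b ^+ size p <= law [set eta | forall z, z \in p -> b < eta z].
Proof.
have -> : [set eta : site -> R | forall z, z \in p -> b < eta z] =
    [set eta | forall z, z \in p -> `]b, +oo[%classic (eta z)].
  by apply/seteqP; split=> eta h z zp; have := h z zp; rewrite /= in_itv/= andbT.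
rewrite (law_cylinder omega_indep p (B := fun=> `]b, +oo[%classic))//.
rewrite (eq_bigr (fun=> tail_prob b)) => [|z _]; last first.
  rewrite (law_site_id omega_id z (0, 0))//; congr (law _).
  by apply/seteqP; split=> eta /=; rewrite in_itv/= andbT.
rewrite big_const_seq count_predT iter_mulr_1; apply: ler_wiXn2l; last exact: size_undup.
- exact/ltW/tail_prob_gt0.
- exact: tail_prob_le1.
Qed.

(** A single path all of whose weights exceed [|x|] suffices. *)
Lemma pass_gt0 v x : le_site (0, 0) v -> v != (0, 0) -> 0 < pass v x.
Proof.
move=> v0 vn0; have [p pp] := up_right_path_exists v0.
apply: (@lt_le_trans _ _ (law [set eta | forall z, z \in p -> `|x| < eta z])).
  apply: lt_le_trans (law_all_gt _ _).
  by rewrite exprn_gt0 ?tail_prob_gt0.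
apply: law_mono => //.
  by apply: (@events_forall R setT site [set` p]) => z _; exact: events_gt.
move=> eta h; exists p => //; case: p pp h => [/andP[_ /eqP /esym/eqP]|z p _ h].
  by rewrite (negbTE vn0).
rewrite /path_weight big_cons (le_trans (ler_norm x))//.
rewrite -[leLHS]addr0; apply: lerD; first by apply/ltW/h; rewrite mem_head.
rewrite big_seq; apply: sumr_ge0 => y yp.
by rewrite ltW// (le_lt_trans (normr_ge0 x))// h// inE yp orbT.
Qed.

(** Almost surely eventually false events form a null limit superior, to which
the probabilities of their tail unions converge. *)
Lemma law_ae_eventually (A : nat -> set (site -> R)) :
  (forall n, events setT (A n)) ->
  {ae P, forall w, exists N, forall n, (N <= n)%N -> ~ A n (weights omega w)} ->
  forall e, 0 < e -> exists N, forall n, (N <= n)%N -> law (A n) <= e.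
Proof.
move=> eA hA e e0; pose F n := [set w | A n (weights omega w)].
have mF n : measurable (F n) by exact: field_measurable (eA n).
have h0 : P (lim_sup_set F) = 0%E.
  apply: (negligibleP _ _).1.
    apply: bigcap_measurable => // n _; exact: bigcup_measurable.
  apply: negligibleS hA => w /= hw [N hN].
  by have [n Nn] := hw N I; exact: hN.
have : P (\bigcup_(k in [set k | (n <= k)%N]) F k) @[n --> \oo] -->
    P (lim_sup_set F).
  apply: lim_sup_set_cvg => //; rewrite (le_lt_trans (probability_le1 _ _)) ?ltry//.
  exact: bigcup_measurable.
rewrite h0.
move=> /fine_cvgP[_ /cvgrPdist_le /(_ _ e0)[N _ hN]].
exists N => n Nn; have := hN n Nn; rewrite /= sub0r normrN.
apply: le_trans; apply: le_trans (ler_norm _).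
have mU : measurable (\bigcup_(k in [set k | (n <= k)%N]) F k).
  exact: bigcup_measurable.
rewrite -lee_fin lawE// fineK ?fin_num_measure//.
apply: le_measure; rewrite ?inE//; first exact: (mF n).
by move=> w Fw; exists n => //=.
Qed.

Section Shape.
Variable m0 : R.
Hypothesis m0P : is_shape_value omega 0 m0.

Lemma shape_eventually e : 0 < e ->
  {ae P, forall w, exists N, forall n, (N <= n)%N ->
    ~ reach (0, 0) (n%:Z, n%:Z) (n.*2%:R * (m0 + e)) (weights omega w) /\
    reach (0, 0) (n%:Z, n%:Z) (n.*2%:R * (m0 - e)) (weights omega w)}.
Proof.
move=> e0; apply: filterS m0P => w /fine_cvgP[[N1 _ h1]].
move=> /cvgrPdist_lt /(_ _ e0)[N2 _ h2].
exists (N1 + N2).+1 => n Nn.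
have n0 : 0 < n.*2%:R :> R by rewrite ltr0n; lia.
have := h1 n.*2 => /= /(_ _); have := h2 n.*2 => /= /(_ _).
have -> : target (0 : R) n.*2 = (n%:Z, n%:Z) :> site.
  rewrite /target mul0r; have := @floor_half R n 0.
  by rewrite !addr0 !subr0.
move=> /(_ ltac:(lia)) + /(_ ltac:(lia)).
have rP x := reachP (weights omega w) (0, 0) (n%:Z, n%:Z) x.
case E : (lpp _ _ _) => [y| |] /=; last 2 first.
- by rewrite gt0_mulye// lte_fin invr_gt0.
- by rewrite gt0_mulNye// lte_fin invr_gt0.
rewrite ltr_distlC => /andP[hy1 hy2] _; split.
  move=> /rP; rewrite E lee_fin leNgt => /negP; apply.
  by rewrite mulrC -ltr_pdivrMr//; lra.
by apply/rP; rewrite E lee_fin mulrC -ler_pdivlMr//; lra.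
Qed.

Lemma shape_above r e : m0 < r -> 0 < e ->
  exists N, forall n, (N <= n)%N -> pass (n%:Z, n%:Z) (n.*2%:R * r) <= e.
Proof.
move=> m0r; apply: law_ae_eventually => //.
have re : 0 < r - m0 by rewrite subr_gt0.
apply: filterS (shape_eventually re) => w [N hN]; exists N => n /hN[+ _].
by rewrite addrC subrK.
Qed.

Lemma shape_below r e : r < m0 -> 0 < e ->
  exists N, forall n, (N <= n)%N -> 1 - pass (n%:Z, n%:Z) (n.*2%:R * r) <= e.
Proof.
move=> m0r e0; suff [N hN] : exists N, forall n, (N <= n)%N ->
    law (~` reach (0, 0) (n%:Z, n%:Z) (n.*2%:R * r)) <= e.
  by exists N => n /hN; rewrite lawC.
apply: law_ae_eventually e0; first by move=> n; exact: eventsC.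
have re : 0 < m0 - r by rewrite subr_gt0.
apply: filterS (shape_eventually re) => w [N hN]; exists N => n /hN[_].
by rewrite opprB addrC subrK => h /(_ h).
Qed.

End Shape.

End Passage.

(** * The rate function *)

Section Fekete.
Variable R : realType.
Variable a : nat -> R.
Hypothesis a_ge0 : forall n, 0 <= a n.
Hypothesis a_sub : forall m n, (2 <= m)%N -> (2 <= n)%N -> a (m + n) <= a m + a n.

Definition fekete_inf : R := inf [set a n / n%:R | n in [set n | (2 <= n)%N]].

Lemma fekete_has_inf : has_inf [set a n / n%:R | n in [set n | (2 <= n)%N]].
Proof.
split; first by exists (a 2 / 2%:R), 2.
by exists 0 => _ [n _ <-]; rewrite divr_ge0.
Qed.

Lemma fekete_inf_ge0 : 0 <= fekete_inf.
Proof.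
apply: lb_le_inf; first by case: fekete_has_inf.
by move=> _ [n _ <-]; rewrite divr_ge0.
Qed.

Lemma fekete_inf_le n : (2 <= n)%N -> n%:R * fekete_inf <= a n.
Proof.
move=> n2; rewrite mulrC -ler_pdivlMr ?ltr0n; last by lia.
by apply: ge_inf; [case: fekete_has_inf|exists n].
Qed.

(** Fekete's lemma, for a sequence that is subadditive from index 2 on: the
remainder of the division of [n] by a good [m] is taken in [m, 2m) so that
small indices never occur. *)
Lemma fekete e : 0 < e -> exists N, forall n, (N <= n)%N ->
  a n <= n%:R * (fekete_inf + e).
Proof.
move=> e0; have e2 : 0 < e / 2 by lra.
have [_ [m m2 <-] hm] := inf_adherent e2 fekete_has_inf.
rewrite -/fekete_inf /= in m2 hm.
have am : a m <= m%:R * (fekete_inf + e / 2).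
  by rewrite mulrC -ler_pdivrMr ?ltr0n ?ltW//; lia.
have iter_sub q s : (2 <= s)%N -> a (q * m + s) <= q%:R * a m + a s.
  move=> s2; elim: q => [|q IH]; first by rewrite mul0r mul0n !add0r.
  rewrite mulSn -addnA (le_trans (a_sub m2 _))//; first by lia.
  by rewrite -natr1; lra.
pose B := \sum_(s < m + m) a s.
have B0 : 0 <= B by apply: sumr_ge0.
have aB s : (s < m + m)%N -> a s <= B.
  move=> sm; rewrite /B (bigD1 (Ordinal sm))//= lerDl.
  by apply: sumr_ge0 => i _.
have [N hN] : exists N, forall n, (N <= n)%N -> B <= n%:R * (e / 2).
  exists (Num.bound (B / (e / 2))) => n Nn.
  rewrite -ler_pdivrMr// ltW// (lt_le_trans (archi_boundP _))//.
    by apply: divr_ge0 => //; exact: ltW.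
  by rewrite ler_nat.
exists (N + m) => n Nn; pose q := (n %/ m).-1; pose s := (m + n %% m)%N.
have m0 : (0 < m)%N by lia.
have nm : (n %% m < m)%N by rewrite ltn_mod.
have nE : (q * m + s)%N = n.
  have q1 : (0 < n %/ m)%N by rewrite divn_gt0//; lia.
  by rewrite /q /s addnA -mulSnr prednK// -divn_eq.
rewrite -[in leLHS]nE (le_trans (iter_sub q s _))//; first by rewrite /s; lia.
have h1 : a s <= n%:R * (e / 2).
  apply: le_trans (aB _ _) (hN _ _); rewrite /s; lia.
have h2 : q%:R * a m <= n%:R * (fekete_inf + e / 2).
  apply: (@le_trans _ _ (q%:R * (m%:R * (fekete_inf + e / 2)))).
    by rewrite ler_wpM2l.
  rewrite mulrA ler_wpM2r//; first by have := fekete_inf_ge0; lra.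
  by rewrite -natrM ler_nat -nE leq_addr.
lra.
Qed.

End Fekete.

Section Target.
Variable R : realType.
Variable t : R.

Lemma le_target v n : le_site v (target t n) =
  (v.1%:~R <= n%:R / 2 + t * n%:R) && (v.2%:~R <= n%:R / 2 - t * n%:R).
Proof. by rewrite /le_site /target /= !floor_ge_int. Qed.

Lemma target_le n : ((target t n).1%:~R <= n%:R / 2 + t * n%:R) &&
  ((target t n).2%:~R <= n%:R / 2 - t * n%:R).
Proof. by rewrite -le_target /le_site !lexx. Qed.

Lemma level_target n : (n%:Z - 1 <= level (target t n) <= n%:Z).
Proof.
have /andP[a1 a2] := floor_itv (n%:R / 2 + t * n%:R : R).
have /andP[b1 b2] := floor_itv (n%:R / 2 - t * n%:R : R).
rewrite !intrD in a2 b2; rewrite /level /target /=.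
move: (Num.floor _) (Num.floor _) a1 a2 b1 b2 => x y a1 a2 b1 b2.
suff : (n%:Z - 1 < x + y + 1) && (x + y <= n%:Z) by lia.
rewrite -(@ltr_int R) -(@ler_int R) !intrD; apply/andP.
by rewrite /= in a1 a2 b1 b2 *; split; lra.
Qed.

Lemma target_super m n :
  le_site (shift (target t m) (target t n)) (target t (m + n)).
Proof.
have /andP[? ?] := target_le m; have /andP[? ?] := target_le n.
by rewrite le_target /shift /= !intrD natrD; apply/andP; split; lra.
Qed.

Lemma target_scale n K :
  le_site (shift (scale_site K (target t n)) (target t n)) (target t (K.+1 * n)).
Proof.
have /andP[? ?] := target_le n; have ? : 0 <= K%:R :> R by [].
rewrite le_target /shift /scale_site /= mulSn natrD natrM !intrD !intrM.
by apply/andP; split; nra.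
Qed.

Hypothesis t_bounds : 0 < t <= 1 / 2.

Lemma target_ge0 n : le_site (0, 0) (target t n).
Proof.
rewrite le_target /=; have := t_bounds; have : 0 <= n%:R :> R by [].
by move=> ? /andP[? ?]; apply/andP; split; nra.
Qed.

Lemma target_neq0 n : (2 <= n)%N -> target t n != (0, 0).
Proof.
move=> n2; apply/eqP => nE; have := le_target (1, 0) n.
rewrite nE /le_site /= => /esym/negbT/negP; apply.
have n2' : 2 <= n%:R :> R by rewrite (ler_nat _ 2 n).
by have /andP[? ?] := t_bounds; apply/andP; split; nra.
Qed.

End Target.

Section Rate.
Variables (R : realType) (d : measure_display) (T : measurableType d).
Variables (P : probability T R) (omega : site -> {RV P >-> R}).
Hypothesis omega_indep : mutually_independent omega.
Hypothesis omega_id : identically_distributed omega.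
Hypothesis omega_ge0 : forall z, {ae P, forall w, 0 <= omega z w}.
Hypothesis omega_unbounded : forall z (beta : R),
  (0 < P [set w | (beta < omega z w)%R])%E.
Variable t : R.
Hypothesis t_bounds : 0 < t <= 1 / 2.
Implicit Types (r : R) (n : nat).

Definition upper_tail r n : R := pass omega (target t n) (r * n%:R).

Lemma upper_tail_gt0 r n : (2 <= n)%N -> 0 < upper_tail r n.
Proof.
by move=> n2; apply: pass_gt0 => //; [exact: target_ge0|exact: target_neq0].
Qed.

Lemma upper_tail_le1 r n : upper_tail r n <= 1. Proof. exact: pass_le1. Qed.

Lemma upper_tail_super r r' m n : upper_tail r m * upper_tail r' n <=
  pass omega (target t (m + n)) (r * m%:R + r' * n%:R).
Proof.
apply: le_trans (pass_super omega_indep omega_id _ _ _ _) _.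
by apply: pass_widen => //; exact: target_super.
Qed.

Definition cost r n : R := - ln (upper_tail r n).

Lemma cost_ge0 r n : 0 <= cost r n.
Proof. by rewrite oppr_ge0 ln_le0// upper_tail_le1. Qed.

Lemma upper_tailE r n : (2 <= n)%N -> upper_tail r n = expR (- cost r n).
Proof. by move=> n2; rewrite opprK lnK// posrE upper_tail_gt0. Qed.

Lemma cost_le r n x : (2 <= n)%N -> expR (- x) <= upper_tail r n -> cost r n <= x.
Proof. by move=> n2; rewrite upper_tailE// ler_expR lerN2. Qed.

Lemma cost_sub r m n : (2 <= m)%N -> (2 <= n)%N ->
  cost r (m + n) <= cost r m + cost r n.
Proof.
move=> m2 n2; apply: cost_le; first by lia.
rewrite opprD expRD -!upper_tailE//; apply: le_trans (upper_tail_super _ _ _ _) _.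
by rewrite /upper_tail natrD mulrDr.
Qed.

Definition rate_fun r : R := fekete_inf (cost r).

Lemma rate_fun_ge0 r : 0 <= rate_fun r.
Proof. exact/fekete_inf_ge0/cost_ge0. Qed.

Lemma cost_ge r n : (2 <= n)%N -> n%:R * rate_fun r <= cost r n.
Proof. exact/fekete_inf_le/cost_ge0. Qed.

Lemma upper_tail_le r n : (2 <= n)%N -> upper_tail r n <= expR (- (n%:R * rate_fun r)).
Proof. by move=> n2; rewrite upper_tailE// ler_expR lerN2 cost_ge. Qed.

Lemma cost_eventually r e : 0 < e -> exists N, forall n, (N <= n)%N ->
  cost r n <= n%:R * (rate_fun r + e).
Proof. by apply: fekete; [exact: cost_ge0|exact: cost_sub]. Qed.

Lemma upper_tail_ge r e : 0 < e -> exists N, forall n, (N <= n)%N ->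
  expR (- (n%:R * (rate_fun r + e))) <= upper_tail r n.
Proof.
move=> /(cost_eventually r)[N hN]; exists (N + 2) => n Nn.
by rewrite upper_tailE ?ler_expR ?lerN2 ?hN//; lia.
Qed.

Lemma rateE r : rate omega t r = (rate_fun r)%:E.
Proof.
have lE n : (2 <= n)%N -> ((n%:R^-1)%:E * lne (P [set w |
     ((r * n%:R)%:E <= lpp (weights omega w) (0%R, 0%R) (target t n))%E]))%E =
    (- (cost r n / n%:R))%:E.
  move=> n2; rewrite [X in P X](_ : _ = [set w |
     reach (0, 0) (target t n) (r * n%:R) (weights omega w)]); last first.
    by apply/seteqP; split=> w /reachP.
  rewrite -lawE; last exact: events_reachT.
  by rewrite lne_EFin ?upper_tail_gt0// -EFinM /cost mulNr opprK mulrC.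
rewrite /rate -[RHS]oppeK; congr (- _)%E; apply: cvg_lim => //.
rewrite -EFinN; apply/fine_cvgP; split.
  by exists 2 => // n /= n2; rewrite lE.
apply/cvgrPdist_le => e e0; have [N hN] := cost_eventually r e0.
exists (N + 2) => // n /= Nn; rewrite lE; last by lia.
have n0 : 0 < n%:R :> R by rewrite ltr0n; lia.
have /(_ _)/= := @cost_ge r n; rewrite -ler_pdivlMl// => /(_ ltac:(lia)) h1.
have := hN n; rewrite -ler_pdivrMl// => /(_ ltac:(lia)) h2.
rewrite /= ler_norml [n%:R^-1 * _]mulrC in h1 h2 *; apply/andP; split; lra.
Qed.

(** Convexity of the rate function along weights [K / (K + 1)], [1 / (K + 1)]:
concatenate [K] copies of one deviation with one copy of another. *)
Lemma rate_fun_mix (K : nat) r r' r'' : K.+1%:R * r = K%:R * r' + r'' ->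
  K.+1%:R * rate_fun r <= K%:R * rate_fun r' + rate_fun r''.
Proof.
move=> rE; apply/ler_addgt0Pr => e e0.
have e1 : 0 < e / K.+1%:R by rewrite divr_gt0.
have [N1 hN1] := cost_eventually r' e1; have [N2 hN2] := cost_eventually r'' e1.
pose n := (N1 + N2 + 2)%N; have n0 : 0 < n%:R :> R by rewrite ltr0n /n; lia.
have h1 := hN1 n ltac:(lia); have h2 := hN2 n ltac:(lia).
have n2 : (2 <= n)%N by rewrite /n; lia.
have h : cost r (K.+1 * n) <= K%:R * cost r' n + cost r'' n.
  apply: cost_le; first by rewrite /n; lia.
  rewrite opprD expRD -upper_tailE// -mulrN expRM_natl -upper_tailE//.
  apply: (@le_trans _ _ (pass omega (scale_site K (target t n)) (K%:R * (r' * n%:R)) *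
      upper_tail r'' n)).
    by rewrite ler_wpM2r ?pass_ge0//; exact: pass_scale.
  apply: le_trans (pass_super omega_indep omega_id _ _ _ _) _.
  rewrite (_ : _ + _ = r * (K.+1 * n)%:R); last first.
    by rewrite natrM [RHS]mulrA [r * _]mulrC rE; ring.
  by apply: pass_widen => //; exact: target_scale.
have := @cost_ge r (K.+1 * n) ltac:(lia) => h3.
rewrite -(ler_pM2l n0); move: h h1 h2 h3; rewrite natrM.
move: (rate_fun r) (rate_fun r') (rate_fun r'') (cost r' n) (cost r'' n) (cost r _).
move=> a b c x y z h h1 h2 h3.
have K0 : 0 <= K%:R :> R by [].
have h4 : K%:R * x <= K%:R * (n%:R * (b + e / K.+1%:R)) by rewrite ler_wpM2l.
have eE : K%:R * (n%:R * (e / K.+1%:R)) + n%:R * (e / K.+1%:R) = n%:R * e.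
  by rewrite -natr1; field; apply: lt0r_neq0; lra.
move: h1 h2 h4 eE; move: (e / K.+1%:R) => q h1 h2 h4 eE.
rewrite mulrCA mulrA (le_trans h3)// (le_trans h)//.
rewrite mulrDr -eE; lra.
Qed.

(** In both directions the comparison with the finite value [rate_fun (r + 1)],
taken with a small weight [1 / (K + 1)], bounds the increment. *)
Lemma rate_fun_left r e : 0 < e ->
  exists2 del, 0 < del & rate_fun r <= rate_fun (r - del) + e.
Proof.
move=> e0; pose K := (Num.bound (rate_fun (r + 1) / e)).+1.
have K0 : 0 < K%:R :> R by rewrite ltr0n.
have hK : rate_fun (r + 1) <= K%:R * e.
  rewrite -ler_pdivrMr// ltW// (lt_le_trans (archi_boundP _))//.
    by rewrite divr_ge0 ?rate_fun_ge0// ltW.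
  by rewrite ler_nat.
exists K%:R^-1; first by rewrite invr_gt0.
have := @rate_fun_mix K r (r - K%:R^-1) (r + 1).
have -> : K.+1%:R * r = K%:R * (r - K%:R^-1) + (r + 1).
  by rewrite -natr1; field; exact: lt0r_neq0.
move=> /(_ erefl); have := rate_fun_ge0 (r - K%:R^-1).
have K1 : 0 < K.+1%:R :> R by rewrite ltr0n.
move=> h1 h2; rewrite -(ler_pM2l K1); move: h1 h2 hK; rewrite -natr1; nra.
Qed.

Lemma rate_fun_right r e : 0 < e ->
  exists2 del, 0 < del & rate_fun (r + del) <= rate_fun r + e.
Proof.
move=> e0; pose K := (Num.bound (rate_fun (r + 1) / e)).
have hK : rate_fun (r + 1) <= K.+1%:R * e.
  rewrite -ler_pdivrMr// ltW// (lt_le_trans (archi_boundP _))//.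
    by rewrite divr_ge0 ?rate_fun_ge0// ltW.
  by rewrite ler_nat.
have K1 : 0 < K.+1%:R :> R by rewrite ltr0n.
exists K.+1%:R^-1; first by rewrite invr_gt0.
have := @rate_fun_mix K (r + K.+1%:R^-1) r (r + 1).
have -> : K.+1%:R * (r + K.+1%:R^-1) = K%:R * r + (r + 1).
  by rewrite mulrDr divff ?lt0r_neq0// -natr1; ring.
move=> /(_ erefl); have := rate_fun_ge0 r.
move=> h1 h2; rewrite -(ler_pM2l K1); move: h1 h2 hK; rewrite -natr1; nra.
Qed.

End Rate.

(** * The lower tail on the diagonal *)

Section LowerTail.
Variables (R : realType) (d : measure_display) (T : measurableType d).
Variables (P : probability T R) (omega : site -> {RV P >-> R}).
Hypothesis omega_indep : mutually_independent omega.
Hypothesis omega_id : identically_distributed omega.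
Hypothesis omega_ge0 : forall z, {ae P, forall w, 0 <= omega z w}.
Local Notation law := (law omega).
Local Notation pass := (pass omega).

Lemma law_exists_le (I : choiceType) (s : seq I) (A : I -> set (site -> R)) :
  (forall i, events setT (A i)) ->
  events setT [set eta | exists2 i, i \in s & A i eta] /\
  law [set eta | exists2 i, i \in s & A i eta] <= \sum_(i <- s) law (A i).
Proof.
move=> eA; elim: s => [|i s [IH1 IH2]].
  rewrite big_nil [X in events _ X](_ : _ = set0).
    split; first exact: events0.
    by rewrite (_ : [set eta | _] = set0) ?law0//; apply/seteqP; split=> eta // -[].
  by apply/seteqP; split=> eta // -[].
have -> : [set eta | exists2 j, j \in i :: s & A j eta] =
    A i `|` [set eta | exists2 i, i \in s & A i eta].
  apply/seteqP; split=> eta /=.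
    move=> [j]; rewrite inE => /orP[/eqP->|js Aj]; first by left.
    by right; exists j.
  move=> [Ai|[j js Aj]]; first by exists i; rewrite ?mem_head.
  by exists j; rewrite // inE js orbT.
split; first exact: eventsU.
by rewrite big_cons (le_trans (lawU_le _ _ _))// lerD2l.
Qed.

(** Counting: when independent rare events occur for a proportion [1 / p] of
the indices, some set of that proportion consists of simultaneous
occurrences, and there are at most [2 ^ #|I|] candidates for it. *)
Lemma law_many_le (I : finType) (p : nat) (F : I -> set site)
    (A : I -> set (site -> R)) :
  (forall i, events (F i) (A i)) ->
  (forall i j z, F i z -> F j z -> i = j) ->
  (forall i, law (A i) <= (4%:R^-1) ^+ p) ->
  law [set eta | exists2 B : {set I}, (#|I| <= p * #|B|)%N &
    forall i, i \in B -> A i eta] <= (2%:R^-1) ^+ #|I|.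
Proof.
move=> eA dF hA; pose s := enum [pred B : {set I} | (#|I| <= p * #|B|)%N].
have eA' i : events setT (A i) by exact: events_sub (eA i).
have eB (B : {set I}) : events setT [set eta | forall i, i \in B -> A i eta].
  exact: (@events_forall R setT I [set` B]).
have [_ h] := law_exists_le s eB; rewrite [X in law X](_ : _ =
  [set eta | exists2 B, B \in s & forall i, i \in B -> A i eta]); last first.
  by apply/seteqP; split=> eta [B hB1 hB2]; exists B => //; move: hB1; rewrite mem_enum.
apply: le_trans h _.
have hB (B : {set I}) : B \in s ->
    law [set eta | forall i, i \in B -> A i eta] <= (4%:R^-1) ^+ #|I|.
  rewrite mem_enum inE => hB.
  have -> : [set eta | forall i, i \in B -> A i eta] =
      [set eta | forall i, i \in enum B -> A i eta].
    by apply/seteqP; split=> eta h i; have := h i; rewrite mem_enum.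
  rewrite (law_indep_seq omega_indep (F := F))// ?enum_uniq//.
  apply: (@le_trans _ _ (\prod_(i <- enum B) (4%:R^-1) ^+ p)).
    by apply: ler_prod => i _; rewrite law_ge0 hA.
  rewrite big_const_seq count_predT iter_mulr_1 -exprM -cardE.
  by apply: ler_wiXn2l => //; rewrite ?invr_ge0 ?invf_le1 ?ler1n// ltr0n.
rewrite big_seq; apply: le_trans (ler_sum _ hB) _.
rewrite -big_seq big_const_seq count_predT -cardE iter_addr_0.
rewrite -[leLHS]mulr_natr; apply: (@le_trans _ _ ((4%:R^-1) ^+ #|I| * (2 ^ #|I|)%:R)).
  rewrite ler_wpM2l ?exprn_ge0 ?invr_ge0// ler_nat (leq_trans (max_card _))//.
  by rewrite -cardsT -powersetT card_powerset cardsT.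
rewrite natrX -exprMn; rewrite (_ : 4%:R^-1 * 2%:R = 2%:R^-1 :> R)//.
by field.
Qed.

(** Corners of [K] parallel chains of [m]-by-[m] boxes along the diagonal.
Neighbouring chains differ by [2 (m + 1)] in the difference of coordinates,
which exceeds the width [2 m] of a chain and keeps their boxes disjoint. *)
Definition corner (K m j i : nat) : site :=
  ((j * m.+1 + i * m)%N%:Z, ((K - j) * m.+1 + i * m)%N%:Z).

Definition box_sites (K m j i : nat) : set site :=
  [set z | [&& le_site (corner K m j i) z, le_site z (corner K m j i.+1) &
    level (corner K m j i) < level z]].

Lemma box_sites_inj K m j i j' i' z : (j < K)%N -> (j' < K)%N ->
  box_sites K m j i z -> box_sites K m j' i' z -> j = j' /\ i = i'.
Proof.
rewrite /box_sites /le_site /level /corner /= => jK j'K h h'.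
have E k : (k < K)%N -> (k * m.+1 + (K - k) * m.+1 = K * m.+1)%N.
  by move=> kK; rewrite -mulnDl subnKC// ltnW.
have E1 := E j jK; have E2 := E j' j'K.
have tri (a b : nat) : [\/ (a.+1 <= b)%N, a = b | (b.+1 <= a)%N].
  by case: (ltngtP a b) => ?; [constructor 1|constructor 3|constructor 2].
have M (a b c : nat) : (a.+1 <= b)%N -> (a * c + c <= b * c)%N.
  by move=> ab; rewrite -mulSnr leq_mul2r ab orbT.
have ii : i = i'.
  have [/(M _ _ m)|//|/(M _ _ m)] := tri i i'; move: h h'; rewrite !mulSn; lia.
split=> //; rewrite -{}ii {i'} in h'.
have [/(M _ _ m.+1)|//|/(M _ _ m.+1)] := tri j j';
  move: h h'; rewrite ?mulSn; lia.
Qed.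

Lemma shift_corner K m j i : corner K m j i.+1 = shift (corner K m j i) (m%:Z, m%:Z).
Proof. by rewrite /corner /shift /= !mulSn; congr pair; lia. Qed.

Lemma reach_chain (eta : site -> R) K m j I (x : R) (bad : nat -> bool) :
  (forall z, 0 <= eta z) -> 0 <= x ->
  (forall i, ~~ bad i -> reach (corner K m j i) (corner K m j i.+1) x eta) ->
  reach (corner K m j 0) (corner K m j I)
    (\sum_(i < I) (if bad i then 0 else x)) eta.
Proof.
move=> eta0 x0 h; elim: I => [|I IH].
  by rewrite big_ord0; apply: reach_nonneg => //; rewrite /le_site !lexx.
rewrite big_ord_recr /=; apply: reach_cat IH _.
case: ifP => b; last by apply: h; rewrite b.
by apply: reach_nonneg => //; rewrite shift_corner /le_site /shift /=; lia.
Qed.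

Lemma pass_nonpos v (x : R) : le_site (0, 0) v -> x <= 0 -> pass v x = 1.
Proof.
move=> v0 x0; apply/eqP; rewrite eq_le pass_le1 -(law_nonneg omega_ge0).
apply: law_mono; [exact: events_nonneg|exact: events_reachT|].
by move=> eta h; exact: reach_nonneg.
Qed.

(** A box is good when its corner-to-corner value is at least [x]; if the
passage value over the whole square is small then every chain has a
proportion of at least [1 / p] bad boxes. *)
Lemma law_not_reach_le (K m I h p : nat) (x y : R) :
  (0 < p)%N -> 0 <= x -> (K * m.+1 + I * m <= h)%N ->
  1 - pass (m%:Z, m%:Z) x <= (4%:R^-1) ^+ p ->
  p%:R * y <= (p.-1 * I)%N%:R * x ->
  1 - pass (h%:Z, h%:Z) y <= (2%:R^-1) ^+ (K * I).
Proof.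
move=> p0 x0 hh hm hy.
pose bad (b : 'I_K * 'I_I) : set (site -> R) :=
  ~` reach (corner K m b.1 b.2) (corner K m b.1 b.2.+1) x.
have cardE : #|{: 'I_K * 'I_I}| = (K * I)%N by rewrite card_prod !card_ord.
have ebad (b : 'I_K * 'I_I) : events (box_sites K m b.1 b.2) (bad b).
  apply: eventsC; apply: events_reach => z h1 h2 h3.
  by rewrite /box_sites /= h1 h2 h3.
have := @law_many_le _ p (fun b : 'I_K * 'I_I => box_sites K m b.1 b.2) bad ebad.
rewrite cardE => /(_ _ _)/(le_trans _) -> //.
- rewrite -lawC; last exact: events_reachT.
  apply: law_mono_nonneg => //.
  + by apply: eventsC; exact: events_reachT.
  + apply: events_exists => B _.
    apply: (@events_forall R setT _ [set` B]) => b _.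
    by apply: events_sub (ebad b).
  move=> eta eta0 nr.
  pose bd j i := `[< ~ reach (corner K m j i) (corner K m j i.+1) x eta >].
  exists (finset (fun b : 'I_K * 'I_I => bd b.1 b.2)); last first.
    by move=> b; rewrite inE => /asboolP.
  have cnt (j : 'I_K) : (I <= p * \sum_(i < I) bd j i)%N.
    rewrite leqNgt; apply/negP => lt; apply: nr.
    have jK := ltn_ord j.
    have c1 : le_site (0, 0) (corner K m j 0) by [].
    have c2 : le_site (corner K m j I) (h%:Z, h%:Z).
      have k1 : (j * m.+1 <= K * m.+1)%N by rewrite leq_mul2r ltnW// orbT.
      have k2 : ((K - j) * m.+1 <= K * m.+1)%N by rewrite leq_mul2r leq_subr orbT.
      by rewrite /le_site /corner /=; lia.
    have c3 i : ~~ bd j i -> reach (corner K m j i) (corner K m j i.+1) x eta.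
      by rewrite /bd => /asboolPn/contrapT.
    have r := reach_widen eta0 c1 c2 (reach_chain I eta0 x0 c3).
    apply: reach_ge r; rewrite -(ler_pM2l (_ : 0 < p%:R)) ?ltr0n// (le_trans hy)//.
    have -> : \sum_(i < I) (if bd j i then 0 else x) =
        (I%:R - (\sum_(i < I) bd j i)%N%:R) * x.
      rewrite natr_sum -[I in I%:R]card_ord -sum1_card natr_sum -sumrB mulr_suml.
      by apply: eq_bigr => i _; case: (bd j i); rewrite ?subrr ?mul0r ?subr0 ?mul1r.
    have pE : (p * I = p.-1 * I + I)%N by rewrite -{1}(prednK p0) mulSn addnC.
    rewrite mulrA ler_wpM2r// mulrBr -!natrM -natrB ?ler_nat; lia.
  have -> : #|(finset (fun b : 'I_K * 'I_I => bd b.1 b.2))| =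
      (\sum_(j < K) \sum_(i < I) bd j i)%N.
    rewrite pair_big /= -sum1_card big_mkcond /=; apply: eq_bigr => b _.
    by rewrite inE; case: (bd _ _).
  rewrite big_distrr /= -{1}[K]card_ord -sum1_card big_distrl /=.
  by apply: leq_sum => j _; rewrite mul1n; exact: cnt.
- move=> [j i] [j' i'] z /= h1 h2.
  have [E1 E2] := box_sites_inj (ltn_ord j) (ltn_ord j') h1 h2.
  by congr pair; exact: val_inj.
- move=> b; rewrite lawC; last exact: events_reachT.
  by rewrite shift_corner law_reach_shift.
Qed.

Variable m0 : R.
Hypothesis m0P : is_shape_value omega 0 m0.

(** The lower tail decays faster than any exponential: with [m] fixed so large
that boxes are bad with small probability, [K] chains give a bound
exponentially small in [K * h / m], and [K] is arbitrary. *)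
Lemma lower_tail (r C : R) : r < m0 -> exists N, forall h, (N <= h)%N ->
  1 - pass (h%:Z, h%:Z) (h.*2%:R * r) <= expR (- (h%:R * C)).
Proof.
move=> rm0; have [r0|r0] := leP r 0.
  exists 0 => h _; rewrite pass_nonpos ?subrr ?expR_ge0//.
  by rewrite mulr_ge0_le0.
pose r1 := (r + m0) / 2; pose r2 := (r + r1) / 2.
have r1m0 : r1 < m0 by rewrite /r1; lra.
have r12 : r2 < r1 by rewrite /r2 /r1; lra.
have rr2 : r < r2 by rewrite /r2 /r1; lra.
have [p [p0 hp]] : exists p : nat, (0 < p)%N /\ p%:R * r2 <= (p.-1)%:R * r1.
  exists (Num.bound (r1 / (r1 - r2))).+1; split=> //=.
  have : r1 / (r1 - r2) < (Num.bound (r1 / (r1 - r2)))%:R.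
    by apply: archi_boundP; apply: divr_ge0; lra.
  rewrite ltr_pdivrMr ?subr_gt0// -natr1.
  by move: (Num.bound _)%:R => b; rewrite mulrBr mulrDl mul1r; lra.
have e0 : 0 < (4%:R^-1) ^+ p :> R by rewrite exprn_gt0 ?invr_gt0.
have [N1 hN1] := shape_below m0P r1m0 e0.
pose m := N1.+1; have hm := hN1 m (leqnSn _).
have ln2 : 0 < ln 2%:R :> R by rewrite ln_gt0 ?ltr1n.
have [K hK] : exists K : nat, `|C| * (2 * m%:R) <= K%:R * ln 2%:R.
  exists (Num.bound (`|C| * (2 * m%:R) / ln 2%:R)).
  rewrite -ler_pdivrMr// ltW//; apply: archi_boundP.
  by rewrite divr_ge0 ?mulr_ge0// ltW.
pose D := (K * m.+1 + m)%N.
have [N2 hN2] : exists N2 : nat, D%:R * r2 <= N2%:R * (r2 - r).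
  exists (Num.bound (D%:R * r2 / (r2 - r))).
  rewrite -ler_pdivrMr ?subr_gt0// ltW//; apply: archi_boundP.
  by apply: divr_ge0; [apply: mulr_ge0 => //; lra|lra].
exists (N2 + D.*2)%N => h hN.
pose I := ((h - K * m.+1) %/ m)%N.
have DN : (D.*2 <= h)%N by apply: leq_trans hN; exact: leq_addl.
have N2h : (N2 <= h)%N by apply: leq_trans hN; exact: leq_addr.
have Kmh : (K * m.+1 <= h)%N.
  by apply: leq_trans DN; rewrite -addnn /D -addnA leq_addr.
have I1 : (K * m.+1 + I * m <= h)%N.
  by rewrite -(subnKC Kmh) leq_add2l leq_divM.
have I2 : (h <= I * m + D)%N.
  rewrite -{1}(subnKC Kmh) /D addnCA leq_add2l -mulSnr ltnW//.
  exact: ltn_ceil.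
have I2R : h%:R <= I%:R * m%:R + D%:R :> R by rewrite -natrM -natrD ler_nat.
apply: le_trans (law_not_reach_le p0 _ I1 hm _) _.
- by rewrite mulr_ge0//; lra.
- rewrite natrM -!muln2 !natrM.
  have h1 : h%:R * r <= I%:R * m%:R * r2.
    have Nh : N2%:R <= h%:R :> R by rewrite ler_nat.
    have k1 : N2%:R * (r2 - r) <= h%:R * (r2 - r) by rewrite ler_wpM2r//; lra.
    have k2 : h%:R * r2 <= (I%:R * m%:R + D%:R) * r2 by rewrite ler_wpM2r//; lra.
    lra.
  have h2 : 0 <= I%:R * m%:R :> R by rewrite mulr_ge0.
  have h3 : I%:R * m%:R * (p%:R * r2) <= I%:R * m%:R * (p.-1%:R * r1).
    by rewrite ler_wpM2l.
  have h4 : p%:R * (h%:R * r) <= p%:R * (I%:R * m%:R * r2) by rewrite ler_wpM2l.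
  lra.
have -> : 2%:R^-1 = expR (- ln 2%:R) :> R by rewrite expRN lnK// posrE.
rewrite -expRM_natl ler_expR mulrN lerN2 natrM.
have h1 : h%:R <= 2 * (I%:R * m%:R) :> R.
  by have : D%:R * 2 <= h%:R :> R; [rewrite -natrM ler_nat muln2|lra].
apply: (@le_trans _ _ (h%:R * `|C|)); first by rewrite ler_wpM2l// ler_norm.
apply: (@le_trans _ _ (2 * (I%:R * m%:R) * `|C|)); first by rewrite ler_wpM2r.
have : I%:R * (`|C| * (2 * m%:R)) <= I%:R * (K%:R * ln 2%:R) by rewrite ler_wpM2l.
lra.
Qed.

End LowerTail.

(** * The upper bound *)

Section EndpointEvents.
Variable R : realType.

(** The chosen geodesic is a function of the set of all geodesics, which takes
finitely many values, each of them on an event. *)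
Lemma events_line_endpoint (S : set site) n : ~~ odd n ->
  events setT [set eta : site -> R | S (line_endpoint eta n)].
Proof.
move=> n2; pose L := paths_from n (0, 0).
pose best (p : seq site) (eta : site -> R) :=
  forall q, q \in L -> path_weight eta q <= path_weight eta p.
pose fits (s : seq (seq site)) (eta : site -> R) :=
  forall p, p \in L -> (best p eta <-> p \in s).
have ebest p : events setT [set eta | best p eta].
  apply: (@events_forall R setT (seq site) [set` L]) => q _.
  exact: events_weight_le.
have geoE eta s : fits s eta ->
    [set p | line_geodesic eta n p] = [set` [seq p <- L | p \in s]].
  move=> hs; apply/seteqP; split=> p /=.
    move=> /(line_geodesicP _ _ n2)[pp sp hp].
    have pL : p \in L by rewrite mem_paths_from sp eqxx.
    rewrite mem_filter pL andbT; apply/(hs p pL) => q.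
    by rewrite mem_paths_from => /andP[/eqP sq qq]; exact: hp.
  rewrite mem_filter => /andP[ps pL]; apply/line_geodesicP => //.
  move: (pL); rewrite mem_paths_from => /andP[/eqP sp pp]; split=> // q qq sq.
  by apply: ((hs p pL).2 ps); rewrite mem_paths_from sq eqxx.
pose chosen (s : seq (seq site)) := last (0, 0) (xget [::] [set` [seq p <- L | p \in s]]).
rewrite [X in events _ X](_ : _ =
  [set eta | exists2 s, S (chosen s) & fits s eta]).
  apply: events_exists => s _.
  apply: (@events_forall R setT (seq site) [set` L]) => p _.
  have [ps|ps] := boolP (p \in s).
    rewrite [X in events _ X](_ : _ = [set eta | best p eta])//.
    by apply/seteqP; split=> eta /=; [move=> [_]; apply|].
  rewrite [X in events _ X](_ : _ = ~` [set eta | best p eta]); first exact: eventsC.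
  apply/seteqP; split=> eta /=; first by move=> [h _] /h.
  by move=> nb; split=> // /nb.
apply/seteqP; split=> eta /=.
  move=> Se; exists [seq p <- L | `[< best p eta >]]; last first.
    move=> p pL; rewrite mem_filter pL andbT.
    by split=> [h|/asboolP//]; exact/asboolP.
  move: Se; rewrite /line_endpoint (geoE _ [seq p <- L | `[< best p eta >]])//.
  move=> p pL; rewrite mem_filter pL andbT.
  by split=> [h|/asboolP//]; exact/asboolP.
by move=> [s Ss /geoE sE]; rewrite /line_endpoint sE.
Qed.

End EndpointEvents.

Section UpperBound.
Variables (R : realType) (d : measure_display) (T : measurableType d).
Variables (P : probability T R) (omega : site -> {RV P >-> R}).
Hypothesis omega_indep : mutually_independent omega.
Hypothesis omega_id : identically_distributed omega.
Hypothesis omega_ge0 : forall z, {ae P, forall w, 0 <= omega z w}.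
Hypothesis omega_unbounded : forall z (beta : R),
  (0 < P [set w | (beta < omega z w)%R])%E.
Variable t : R.
Hypothesis t_bounds : 0 < t <= 1 / 2.
Variable m0 : R.
Hypothesis m0P : is_shape_value omega 0 m0.
Local Notation law := (law omega).
Local Notation pass := (pass omega).
Local Notation J := (rate_fun omega t).

Definition ends_beyond n : set (site -> R) :=
  [set eta | Num.floor (n%:R / 2 + t * n%:R : R) <= (line_endpoint eta n).1].

Lemma events_ends_beyond n : ~~ odd n -> events setT (ends_beyond n).
Proof.
exact: (@events_line_endpoint R
  [set z : site | Num.floor (n%:R / 2 + t * n%:R : R) <= z.1]).
Qed.

(** A geodesic ending beyond direction [t] has at least the weight of every path
to the diagonal point, and ends at one of the points [(h + k, h - k)]. The
strict inequality [t n - 1 < k] accounts for the integer part. *)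
Lemma law_ends_beyond_le h (r : R) : law (ends_beyond h.*2) <=
  (1 - pass (h%:Z, h%:Z) (h.*2%:R * r)) +
  \sum_(k <- [seq k <- iota 0 h.+1 | t * h.*2%:R - 1 < k%:R])
     pass (h%:Z + k%:Z, h%:Z - k%:Z) (h.*2%:R * r).
Proof.
set s := [seq k <- _ | _].
have [es hs] := law_exists_le omega s (A := fun k : nat =>
  reach (0, 0) (h%:Z + k%:Z, h%:Z - k%:Z) (h.*2%:R * r))
  (fun k => events_reachT _ _ _).
rewrite -lawC; last exact: events_reachT.
have eC := eventsC (@events_reachT R (0, 0) (h%:Z, h%:Z) (h.*2%:R * r)).
apply: le_trans (lerD (lexx _) hs); apply: le_trans (lawU_le _ eC es).
apply: law_mono.
- by apply: events_ends_beyond; rewrite odd_double.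
- exact: eventsU.
move=> eta hge; have [[q qq xq]|nr] := pselect
  (reach (0, 0) (h%:Z, h%:Z) (h.*2%:R * r) eta); last by left.
right; have [p [pp sp hp]] := line_endpointP eta (negbT (odd_double h)).
have sq : size q = h.*2.
  by have := size_up_right_path qq; rewrite /level /=; lia.
move: hge; rewrite /ends_beyond /=; case E : (line_endpoint eta h.*2) => [e1 e2] /=.
rewrite {}E in pp => fl; have l := level_path (proj1 (andP pp)).
have /andP[_ /eqP lE] := pp; rewrite lE sp /level /= in l.
have := up_right_path_le pp; rewrite /le_site /= => /andP[e10 e20].
have flb : t * h.*2%:R - 1 < e1%:~R - h%:R.
  have /andP[_ f2] := floor_itv (h.*2%:R / 2 + t * h.*2%:R : R).
  have : (Num.floor (h.*2%:R / 2 + t * h.*2%:R : R) + 1)%:~R <= e1%:~R + 1 :> R.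
    by rewrite -[1 in leRHS]/(1%:~R) -intrD ler_int; lia.
  have -> : h.*2%:R = h%:R * 2 :> R by rewrite -muln2 natrM.
  move: f2; have -> : h.*2%:R = h%:R * 2 :> R by rewrite -muln2 natrM.
  by move=> f2 f3; lra.
have t0 : 0 <= t * h.*2%:R.
  by have /andP[? _] := t_bounds; rewrite mulr_ge0// ltW.
have e1h : h%:Z <= e1.
  rewrite -ltzD1 -(ltr_int R) rmorphD /=.
  rewrite -[(h%:Z)%:~R]/(h%:R : R); lra.
have kE : e1 = h%:Z + (absz (e1 - h%:Z))%:Z by lia.
exists (absz (e1 - h%:Z)).
  rewrite mem_filter mem_iota /=; apply/andP; split; last by lia.
  have kR : e1%:~R = h%:R + (absz (e1 - h%:Z))%:R :> R by rewrite {1}kE rmorphD.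
  by rewrite kR in flb; lra.
exists p; last by rewrite (le_trans xq)// hp//; case/andP: qq.
by rewrite -kE (_ : h%:Z - _ = e2)//; lia.
Qed.

(** For [k] not much below [t n], suitable numbers of copies of the displacement
[(h + k, h - k)] and of its mirror image add up to a displacement below the
one of direction [t] and length [(N + 2) n]; the two extra units of length
absorb the rounding. *)
Lemma pass_far_le h k N (x : R) : (0 < N)%N -> (k <= h)%N ->
  t * ((N + 2) * h.*2)%:R <= (N * k)%:R + h.*2%:R ->
  pass (h%:Z + k%:Z, h%:Z - k%:Z) x ^+ N <=
  pass (target t ((N + 2) * h.*2)) (N%:R * x).
Proof.
move=> N0 kh hk; set M := ((N + 2) * h.*2)%N in hk *.
have t0 : 0 < t by case/andP: t_bounds.
have kh2 : k%:R * 2 <= h.*2%:R :> R by rewrite -natrM ler_nat; lia.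
have ex : exists b : nat, (N%:R - b%:R * 2) * k%:R <= t * M%:R + h.*2%:R :> R.
  exists N; have : 0 <= N%:R * k%:R :> R by rewrite mulr_ge0.
  have : 0 <= t * M%:R by rewrite mulr_ge0// ltW.
  have : 0 <= h.*2%:R :> R by [].
  nra.
have [b hb bmin] := ex_minnP ex.
have hb2 : t * M%:R - h.*2%:R <= (N%:R - b%:R * 2) * k%:R.
  case: b {hb} bmin => [|b] bmin.
    by move: hk; rewrite natrM mulr0n mul0r subr0; lra.
  have : ~~ ((N%:R - b%:R * 2) * k%:R <= t * M%:R + h.*2%:R :> R).
    by apply/negP => /bmin; rewrite ltnn.
  have : 0 <= h.*2%:R :> R by [].
  by rewrite -ltNge -[b.+1%:R]natr1; lra.
have bN : (b <= N)%N.
  apply: bmin; have : 0 <= N%:R * k%:R :> R by rewrite mulr_ge0.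
  have : 0 <= t * M%:R by rewrite mulr_ge0// ltW.
  have : 0 <= h.*2%:R :> R by [].
  nra.
rewrite -[in leLHS](subnK bN) -[in leRHS](subnK bN).
apply: pass_mix => //; rewrite le_target /shift /scale_site /flip /=.
have bR : (N - b)%:R = N%:R - b%:R :> R by rewrite natrB.
have MR : M%:R = (N%:R + 2) * (h%:R * 2) :> R.
  by rewrite /M natrM natrD -muln2 natrM.
have hR : h.*2%:R = h%:R * 2 :> R by rewrite -muln2 natrM.
have z x' : (x'%:Z)%:~R = x'%:R :> R by [].
rewrite !(intrD, intrM, intrB, z) bR; clear bmin ex; apply/andP; split; lra.
Qed.

(** The line value is rarely below [m0 n], and reaching that value beyond
direction [t] costs at least as much as in direction [t] itself. The loss of
a factor [N / (N + 2)] in the weight per step is absorbed by the left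
continuity of the rate function. *)
Lemma ends_beyond_le e : 0 < e -> exists N0, forall h, (N0 <= h)%N ->
  law (ends_beyond h.*2) <= expR (- (h.*2%:R * (J m0 - e))).
Proof.
move=> e0; have /andP[t0 t2] := t_bounds.
have e4 : 0 < e / 4%:R by lra.
have [del del0 hdel] := rate_fun_left omega_indep omega_id omega_ge0
  omega_unbounded t_bounds m0 e4.
pose r := m0 - del / 2; have rm0 : r < m0 by rewrite /r; lra.
have J0 x : 0 <= J x by exact: rate_fun_ge0.
have [N [N0 hN]] : exists N, (0 < N)%N /\ (m0 - del) * (N%:R + 2) <= N%:R * r.
  exists (Num.bound (2 * `|m0 - del| / (del / 2))).+1; split=> //.
  have : 2 * `|m0 - del| / (del / 2) < (Num.bound (2 * `|m0 - del| / (del / 2)))%:R.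
    by apply: archi_boundP; rewrite divr_ge0 ?mulr_ge0//; lra.
  rewrite ltr_pdivrMr; last by lra.
  rewrite -[(Num.bound _).+1%:R]natr1; move: (Num.bound _)%:R => b; have := ler_norm (m0 - del).
  by rewrite /r; lra.
have [N1 hN1] := lower_tail omega_indep omega_id omega_ge0 m0P (2 * J m0) rm0.
have [N2 hN2] : exists N2 : nat, t < 1 / 2 -> N%:R <= N2%:R * (1 - 2 * t).
  have [tl|tg] := ltP t (1 / 2); last by exists 0.
  exists (Num.bound (N%:R / (1 - 2 * t))) => _.
  rewrite -ler_pdivrMr; last by lra.
  by rewrite ltW//; apply: archi_boundP; apply: divr_ge0 => //; lra.
have [N3 hN3] : exists N3 : nat, 1 <= N3%:R * (e / 2 * (e / 2)).
  exists (Num.bound (1 / (e / 2 * (e / 2)))).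
  rewrite -ler_pdivrMr ?mulr_gt0 ?divr_gt0// ltW//; apply: archi_boundP.
  by rewrite divr_ge0// mulr_ge0// ltW// divr_gt0.
exists (N1 + N2 + N3 + 1)%N => h hh.
have hR : h.*2%:R = h%:R * 2 :> R by rewrite -muln2 natrM.
have /and4P[h0 N1h N2h N3h] : [&& 0 < h, N1 <= h, N2 <= h & N3 <= h]%N.
  by move: hh; clear; lia.
have h1 : 1 <= h%:R :> R by rewrite (ler_nat _ 1).
have hN2R : N2%:R <= h%:R :> R by rewrite ler_nat.
have hN3R : N3%:R <= h%:R :> R by rewrite ler_nat.
have one k : (k <= h)%N -> t * h.*2%:R - 1 < k%:R ->
    pass (h%:Z + k%:Z, h%:Z - k%:Z) (h.*2%:R * r) <=
    expR (- (h.*2%:R * (J m0 - e / 4%:R))).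
  move=> kh kt; rewrite -(@ler_pXn2r _ N)// ?nnegrE ?pass_ge0 ?expR_ge0//.
  apply: le_trans (pass_far_le _ N0 kh _) _.
    rewrite !natrM natrD.
    have [tl|tg] := ltP t (1 / 2).
      have k1 : N%:R <= h.*2%:R * (1 - 2 * t).
        apply: (le_trans (hN2 tl)); rewrite ler_wpM2r//; first by lra.
        by rewrite hR; lra.
      have k2 : N%:R * (t * h.*2%:R - 1) <= N%:R * k%:R.
        by rewrite ler_wpM2l// ltW.
      lra.
    have tE : t = 1 / 2 by apply/eqP; rewrite eq_le t2 tg.
    have kE : k = h.
      apply/eqP; rewrite eqn_leq kh /=.
      by rewrite -ltnS -(ltr_nat R) -[k.+1%:R]natr1; move: kt; rewrite tE hR; lra.
    by rewrite kE tE hR; lra.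
  set M := ((N + 2) * h.*2)%N.
  have MR : M%:R = (N%:R + 2) * h.*2%:R :> R by rewrite /M natrM natrD.
  have step : pass (target t M) (N%:R * (h.*2%:R * r)) <= upper_tail omega t (m0 - del) M.
    apply: pass_ge; rewrite MR.
    by have := ler_wpM2r (ler0n R h.*2) hN; lra.
  apply: le_trans step _.
  have M2 : (2 <= M)%N by rewrite /M; move: N0 h0; clear; nia.
  have := upper_tail_le omega_indep omega_id omega_unbounded t_bounds (m0 - del) M2.
  move/le_trans; apply.
  rewrite -expRM_natl ler_expR. rewrite [N%:R * _]mulrN lerN2 MR mulrA.
  have k1 : 0 <= h.*2%:R :> R by [].
  have k2 : 0 <= N%:R :> R by [].
  have k3 := J0 (m0 - del).
  apply: (@le_trans _ _ (N%:R * h.*2%:R * J (m0 - del))).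
    by rewrite ler_wpM2l ?mulr_ge0//; lra.
  by rewrite ler_wpM2r// mulrDl lerDl mulr_ge0.
apply: le_trans (law_ends_beyond_le h r) _.
have b1 : 1 - pass (h%:Z, h%:Z) (h.*2%:R * r) <= expR (- (h.*2%:R * (J m0 - e / 4%:R))).
  apply: (le_trans (hN1 h N1h)).
  rewrite ler_expR lerN2 hR; have := J0 m0; have : 0 <= h%:R * e by rewrite mulr_ge0// ltW.
  lra.
set E := expR _ in b1 one.
have b2 : \sum_(k <- [seq k <- iota 0 h.+1 | t * h.*2%:R - 1 < k%:R])
     pass (h%:Z + k%:Z, h%:Z - k%:Z) (h.*2%:R * r) <= h.+1%:R * E.
  apply: (@le_trans _ _ (\sum_(k <- [seq k <- iota 0 h.+1 | t * h.*2%:R - 1 < k%:R]) E)).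
    rewrite big_seq [leRHS]big_seq; apply: ler_sum => k.
    rewrite mem_filter mem_iota add0n => /andP[k1 /andP[_ k2]]; exact: one.
  rewrite big_const_seq count_predT iter_addr_0 -[leLHS]mulr_natl ler_wpM2r ?expR_ge0//.
  by rewrite ler_nat size_filter (leq_trans (count_size _ _))// size_iota.
apply: le_trans (lerD b1 b2) _.
have -> : expR (- (h.*2%:R * (J m0 - e))) = expR (h.*2%:R * (e - e / 4%:R)) * E.
  by rewrite -expRD; congr expR; ring.
rewrite -{1}[E]mul1r -mulrDl ler_wpM2r ?expR_ge0//.
have x0 : 0 <= h.*2%:R * (e - e / 4%:R) by rewrite mulr_ge0//; lra.
apply: le_trans (expR_ge1Dxn 1 x0); rewrite -[h.+1%:R]natr1 hR.
have -> : (2 `! = 2)%N by [].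
have k1 : h%:R * (h%:R * (e / 2 * (e / 2))) >= h%:R.
  rewrite -[leLHS]mulr1 ler_wpM2l// (le_trans hN3)// ler_wpM2r// mulr_ge0// ltW//; lra.
rewrite expr2; nra.
Qed.

End UpperBound.

(** * A path that beats all competitors *)

Lemma le_site_diag y y' (n : int) : le_site y y' -> level y' = n ->
  le_site y' (shift y (n - level y, n - level y)).
Proof. by rewrite /le_site /level /shift /=; lia. Qed.

Section Comparison.
Variable R : realType.
Implicit Types (eta : site -> R) (Z p q : seq site).

Definition off_weight Z eta p : R := path_weight eta [seq z <- p | z \notin Z].

Definition light Z (s : site * site * R) : set (site -> R) :=
  [set eta | forall p, up_right_path s.1.1 s.1.2 p -> off_weight Z eta p < s.2].

Lemma light_path Z a c x eta y y' q : (forall z, 0 <= eta z) ->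
  light Z (a, c, x) eta -> up_right_path y y' q -> all (fun z => z \notin Z) q ->
  le_site a y -> le_site y' c -> path_weight eta q < x.
Proof.
move=> eta0 lt qq qZ /up_right_path_exists[p1 pp1] /up_right_path_exists[p2 pp2].
apply: le_lt_trans (lt (p1 ++ q ++ p2) _); last first.
  by apply: up_right_path_cat pp1 _; exact: up_right_path_cat pp2.
rewrite /off_weight !filter_cat !path_weight_cat (all_filterP qZ).
by rewrite addrCA lerDl addr_ge0// path_weight_ge0.
Qed.

Lemma last_visit (x : site) (Z pi : seq site) : exists p q, [/\ pi = p ++ q,
  last x p \in x :: Z & all (fun z => z \notin Z) q].
Proof.
elim/last_ind: pi => [|pi z [p [q [piE lp qZ]]]].
  by exists [::], [::]; rewrite /= mem_head.
have [zZ|zZ] := boolP (z \in Z).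
  by exists (rcons pi z), [::]; rewrite cats0 last_rcons inE zZ orbT.
by exists p, (rcons q z); rewrite -rcons_cat -piE all_rcons zZ.
Qed.

(** A path ending elsewhere improves by following [gam] after their last common
vertex, hence is not a geodesic. *)
Lemma line_endpoint_eq eta n gam v : ~~ odd n ->
  up_right_path (0, 0) v gam -> size gam = n ->
  (forall p1 p2 q, gam = p1 ++ p2 -> p2 != [::] ->
     path up_right_step (last (0, 0) p1) q -> size q = size p2 ->
     all (fun z => z \notin gam) q ->
     path_weight eta q < path_weight eta p2) ->
  line_endpoint eta n = v.
Proof.
move=> n2 gp gn hg; have [pi [pp sp hp]] := line_endpointP eta n2.
have [//|ev] := eqVneq (line_endpoint eta n) v.
move: (line_endpoint eta n) pp ev => e pp ev.
have [p [q [piE lp qZ]]] := last_visit (0, 0) gam pi.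
case/splitPl gE : {1}gam / lp => [p1 p2 lp1].
have pp1 := pp; rewrite piE up_right_path_catE in pp1.
case/andP: pp1 => pp1 qq.
have gp1 := gp; rewrite gE up_right_path_catE in gp1.
case/andP: gp1 => gp1 gp2.
have s1 : size p = size p1.
  have := size_up_right_path pp1; have := size_up_right_path gp1.
  by rewrite lp1 => <- [].
have s2 : size q = size p2.
  move: sp; rewrite -gn piE gE !size_cat s1; exact: addnI.
have p2n : p2 != [::].
  apply: contraNneq ev => p20; move: s2; rewrite p20 => /size0nil q0.
  move: qq gp2; rewrite q0 p20 /up_right_path /= lp1 => /eqP <- /eqP <-.
  exact: eqxx.
have := hg p1 p2 q gE p2n; rewrite lp1 => /(_ (proj1 (andP qq)) s2 qZ) lt.
have := hp (p ++ p2); rewrite size_cat -s2 -size_cat -piE sp.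
move=> /(_ _ erefl); rewrite piE !path_weight_cat lerD2l leNgt lt => /(_ _) h.
suff // : false by []; apply: h.
by rewrite cat_path (proj1 (andP pp1)) -lp1 (proj1 (andP gp2)).
Qed.

(** Evenly spread weight. The defect [m] allows concatenation of blocks of
length [m] each of which is only known to be heavy as a whole. The condition
on all suffixes is what a competitor leaving the path in its middle has to
be compared with. *)
Definition heavy (m : nat) (r : R) (gam : seq site) : set (site -> R) :=
  [set eta | forall k, r * ((size (drop k gam))%:R - m%:R) <=
     path_weight eta (drop k gam)].

Lemma heavy_cat m r p q eta : (forall z, 0 <= eta z) -> 0 <= r ->
  heavy m r p eta -> r * m%:R <= path_weight eta q -> (size q <= m)%N ->
  heavy m r (p ++ q) eta.
Proof.
move=> eta0 r0 hp hq qm k; rewrite drop_cat; case: ltnP => kp.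
  have := hp k; rewrite size_cat path_weight_cat natrD.
  have : r * (size q)%:R <= r * m%:R by rewrite ler_wpM2l// ler_nat.
  lra.
apply: le_trans (path_weight_ge0 _ eta0); rewrite mulr_ge0_le0// subr_le0 ler_nat.
by rewrite size_drop (leq_trans (leq_subr _ _)).
Qed.

Definition grid_site (m : nat) (a : nat * nat) : site :=
  ((a.1 * m)%N%:Z, (a.2 * m)%N%:Z).

Definition grid (Q : nat) : seq (nat * nat) :=
  [seq (i, j) | i <- iota 0 Q.+1, j <- iota 0 Q.+1].

(** Constraints at two scales. The grid of mesh [m] has boundedly many points
and controls competitors leaving the heavy part of the path, where the
planted segment makes up for the rounding; a competitor leaving the final
segment close to the line must be controlled at its own scale, and there a
crude linear bound is enough because the planted weights are large. *)
Definition grid_constraints (m Q : nat) (r : R) : seq (site * site * R) :=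
  [seq (grid_site m ac.1, grid_site m ac.2,
        r * (level (grid_site m ac.2) - level (grid_site m ac.1))%:~R)
  | ac <- [seq (a, c) | a <- grid Q, c <- grid Q]
  & (ac.1.1 < ac.2.1)%N && (ac.1.2 < ac.2.2)%N].

Definition near_constraints (n : nat) (b : R) (p : seq site) :
    seq (site * site * R) :=
  [seq (y, shift y (n%:Z - level y, n%:Z - level y), b * (n%:Z - level y)%:~R)
  | y <- p & level y < n%:Z].

Lemma mem_grid Q i j : ((i, j) \in grid Q) = (i <= Q)%N && (j <= Q)%N.
Proof.
apply/allpairsP/idP => [[[i' j'] []]|/andP[iQ jQ]].
  by rewrite !mem_iota !add0n !ltnS /= => iQ jQ [-> ->]; rewrite iQ.
by exists (i, j); rewrite !mem_iota !add0n !ltnS.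
Qed.

Lemma size_grid_constraints m Q r :
  (size (grid_constraints m Q r) <= Q.+1 * Q.+1 * (Q.+1 * Q.+1))%N.
Proof.
rewrite size_map size_filter (leq_trans (count_size _ _))//.
by rewrite !size_allpairs !size_iota.
Qed.

Lemma size_near_constraints n b p : (size (near_constraints n b p) <= size p)%N.
Proof. by rewrite size_map size_filter count_size. Qed.

Lemma grid_light_path Z eta m n r y y' q : (forall z, 0 <= eta z) -> 0 <= r ->
  (0 < m)%N -> (forall s, s \in grid_constraints m (n %/ m).+1 r -> light Z s eta) ->
  le_site (0, 0) y -> level y' <= n%:Z -> up_right_path y y' q ->
  all (fun z => z \notin Z) q ->
  path_weight eta q < r * ((size q)%:R + 4%:R * m%:R).
Proof.
move=> eta0 r0 m0 hS y0 y'n qq qZ; have yy' := up_right_path_le qq.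
have sq := size_up_right_path qq.
move: y y' y0 y'n qq yy' sq => [y1 y2] [x1 x2].
rewrite /le_site /level /= => /andP[]; case: y1 => // y1 _; case: y2 => // y2 _.
move=> xn qq /andP[yx1 yx2] sq; have x1p : 0 <= x1 by lia.
have x2p : 0 <= x2 by lia.
case: x1 x1p xn qq yx1 sq => // x1 _; case: x2 x2p yx2 => // x2 _ yx2 xn qq yx1 sq.
pose a := ((y1 %/ m)%N, (y2 %/ m)%N).
pose c := ((x1 %/ m).+1, (x2 %/ m).+1).
have x1n : (x1 <= n)%N by lia.
have x2n : (x2 <= n)%N by lia.
have yx1' : (y1 <= x1)%N by lia.
have yx2' : (y2 <= x2)%N by lia.
have sin : (grid_site m a, grid_site m c,
    r * (level (grid_site m c) - level (grid_site m a))%:~R) \in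
    grid_constraints m (n %/ m).+1 r.
  apply/mapP; exists (a, c) => //; rewrite mem_filter; apply/andP; split.
    by rewrite /= !ltnS !leq_div2r.
  apply/allpairsP; exists (a, c); split => //.
    by rewrite mem_grid /=; apply/andP; split; apply: leqW; apply: leq_div2r; lia.
  by rewrite mem_grid /= !ltnS !leq_div2r.
have h1 := leq_divM y1 m; have h2 := leq_divM y2 m.
have h3 := ltnW (ltn_ceil x1 m0); have h4 := ltnW (ltn_ceil x2 m0).
have h5 := ltnW (ltn_ceil y1 m0); have h6 := ltnW (ltn_ceil y2 m0).
have h7 := leq_divM x1 m; have h8 := leq_divM x2 m.
apply: lt_le_trans (light_path eta0 (hS _ sin) qq qZ _ _) _.
- by rewrite /le_site /grid_site /=; lia.
- by rewrite /le_site /grid_site /=; lia.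
rewrite ler_wpM2l// -natrM -natrD.
rewrite -[(size q + 4 * m)%:R]/((size q + 4 * m)%N%:Z%:~R) ler_int.
move: h5 h6 h7 h8 sq; rewrite /level /grid_site /= !mulSn.
move: (y1 %/ m * m)%N (y2 %/ m * m)%N (x1 %/ m * m)%N (x2 %/ m * m)%N.
move: (size q) => L m1 m2 m3 m4; clear; lia.
Qed.

(** A competitor leaving the heavy part [l] steps before the line gains less
than [r (l + 4 m)], whereas staying gains at least [r (l - f - m) + b f] with
[f >= m] the length of the final segment; this is why [b >= 6 r] is asked
for. *)
Lemma planted_endpoint eta n m b r gam fin u v : ~~ odd n ->
  (forall z, 0 <= eta z) -> 0 <= r -> 6%:R * r <= b -> (0 < m <= size fin)%N ->
  up_right_path (0, 0) u gam -> up_right_path u v fin ->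
  (size gam + size fin)%N = n -> heavy m r gam eta ->
  (forall z, z \in fin -> b < eta z) ->
  (forall s, s \in grid_constraints m (n %/ m).+1 r ++ near_constraints n b (u :: fin) ->
     light (gam ++ fin) s eta) ->
  line_endpoint eta n = v.
Proof.
move=> n2 eta0 r0 rb /andP[m0 mfin] gp fp sn hv hb hS.
have fp' := up_right_path_cat gp fp.
have vn : level v = n%:Z.
  by have := size_up_right_path fp'; rewrite size_cat sn /level /=; lia.
have fin_ge p : {subset p <= fin} -> b * (size p)%:R <= path_weight eta p.
  elim: p => [_|z p IH pf]; first by rewrite mulr0 /path_weight big_nil.
  rewrite /path_weight big_cons -natr1 mulrDr mulr1 addrC lerD//.
    by apply/ltW/hb/pf; rewrite mem_head.
  by apply: IH => x xp; apply: pf; rewrite inE xp orbT.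
apply: (line_endpoint_eq n2 fp'); first by rewrite size_cat.
move=> p1 p2 q gE p2n qs sq qZ.
have fp'' := fp'; rewrite gE up_right_path_catE in fp''.
case/andP: fp'' => pp1 pp2.
set y := last _ p1 in qs pp1 pp2; pose y' := last y q.
have qq : up_right_path y y' q by rewrite /up_right_path qs eqxx.
have y0 := up_right_path_le pp1.
have y'n : level y' = n%:Z.
  rewrite -vn; have := size_up_right_path qq.
  by rewrite sq (size_up_right_path pp2) => /addIr.
have sE : (size p1 + size p2)%N = n by rewrite -size_cat -gE size_cat.
have [s1|s1] := leqP (size gam) (size p1).
  (* The path is left on its final segment. *)
  have p2E : p2 = drop (size p1 - size gam) fin.
    have : drop (size p1) (gam ++ fin) = p2 by rewrite gE drop_size_cat.
    by rewrite drop_cat ltnNge s1.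
  have yfin : y \in u :: fin.
    have p1E : p1 = gam ++ take (size p1 - size gam) fin.
      have : take (size p1) (gam ++ fin) = p1 by rewrite gE take_size_cat.
      by rewrite take_cat ltnNge s1.
    rewrite /y p1E last_cat; case/andP: (gp) => _ /eqP ->.
    have := mem_last u (take (size p1 - size gam) fin).
    by rewrite !inE => /orP[->//|/mem_take ->]; rewrite orbT.
  have lE : n%:Z - level y = (size p2)%:Z by rewrite -vn (size_up_right_path pp2).
  have p20 : (0 < size p2)%N by rewrite lt0n size_eq0.
  have sin : (y, shift y (n%:Z - level y, n%:Z - level y),
      b * (n%:Z - level y)%:~R) \in near_constraints n b (u :: fin).
    by apply: map_f; rewrite mem_filter yfin andbT -subr_gt0 lE.
  have lt : light (gam ++ fin) (y, shift y (n%:Z - level y, n%:Z - level y),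
      b * (n%:Z - level y)%:~R) eta.
    by apply: hS; rewrite mem_cat sin orbT.
  apply: lt_le_trans (light_path eta0 lt qq qZ _ _) _.
  - by rewrite /le_site !lexx.
  - exact: le_site_diag (up_right_path_le qq) y'n.
  rewrite lE; apply: fin_ge => z; rewrite p2E; exact: mem_drop.
(* The path is left before its final segment. *)
have p2E : p2 = drop (size p1) gam ++ fin.
  have : drop (size p1) (gam ++ fin) = p2 by rewrite gE drop_size_cat.
  by rewrite drop_cat s1.
have hG s : s \in grid_constraints m (n %/ m).+1 r -> light (gam ++ fin) s eta.
  by move=> sG; apply: hS; rewrite mem_cat sG.
apply: lt_le_trans (grid_light_path eta0 r0 m0 hG y0 _ qq qZ) _; first by rewrite y'n.
rewrite sq p2E path_weight_cat size_cat natrD.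
have h1 := hv (size p1); have h2 := fin_ge fin (fun _ => id).
have h3 : r * m%:R <= r * (size fin)%:R by rewrite ler_wpM2l// ler_nat.
have h4 : 6%:R * r * (size fin)%:R <= b * (size fin)%:R by rewrite ler_wpM2r.
move: h1 h2 h3 h4; move: (path_weight _ _) (path_weight _ _) => X Y h1 h2 h3 h4; lra.
Qed.

End Comparison.

(** * Probability of the planted configuration *)

Section PlantedPath.
Variables (R : realType) (d : measure_display) (T : measurableType d).
Variables (P : probability T R) (omega : site -> {RV P >-> R}).
Hypothesis omega_indep : mutually_independent omega.
Hypothesis omega_id : identically_distributed omega.
Hypothesis omega_ge0 : forall z, {ae P, forall w, 0 <= omega z w}.
Hypothesis omega_unbounded : forall z (beta : R),
  (0 < P [set w | (beta < omega z w)%R])%E.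
Variable m0 : R.
Hypothesis m0P : is_shape_value omega 0 m0.
Local Notation law := (law omega).
Local Notation pass := (pass omega).

Lemma events_light (Z : seq site) (s : site * site * R) (F : set site) :
  (forall z, z \notin Z -> le_site s.1.1 z -> le_site z s.1.2 ->
     level s.1.1 < level z -> F z) ->
  events F (light Z s).
Proof.
move=> hF; apply: (@events_forall R F (seq site)
  [set p | up_right_path s.1.1 s.1.2 p]) => p pp.
rewrite [X in events _ X](_ : _ =
  [set eta | `]-oo, s.2[%classic (path_weight eta [seq z <- p | z \notin Z])]).
  apply: events_sum => // z; rewrite mem_filter => /andP[zZ zp].
  by have /and3P[? ? ?] := mem_up_right_path pp zp; exact: hF.
by apply/seteqP; split=> eta /=; rewrite in_itv.
Qed.

Lemma decreasing_le (z : site) (eta eta' : site -> R) :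
  (forall y, y != z -> eta' y = eta y) -> eta' z <= eta z ->
  forall y, eta' y <= eta y.
Proof. by move=> h hz y; have [->//|/h ->] := eqVneq y z. Qed.

Lemma decreasing_light (Z : seq site) (s : site * site * R) z :
  decreasing_at z (light Z s).
Proof.
move=> eta eta' h1 h2 lt p pp; apply: le_lt_trans (lt p pp).
by apply: ler_sum => y _; exact: decreasing_le h2 y.
Qed.

Lemma law_light (Z : seq site) a c x :
  1 - pass (c.1 - a.1, c.2 - a.2) x <= law (light Z (a, c, x)).
Proof.
have cE : c = shift a (c.1 - a.1, c.2 - a.2).
  by case: c => c1 c2; rewrite /shift /=; congr pair; rewrite addrC subrKC.
rewrite -(law_reach_shift omega_indep omega_id a) -cE.
rewrite -lawC; last exact: events_reachT.
apply: law_mono_nonneg => //.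
- by apply: eventsC; exact: events_reachT.
- exact: events_light.
move=> eta eta0 nr p pp; rewrite ltNge; apply/negP => /= le; apply: nr.
exists p => //; apply: (le_trans le).
rewrite /off_weight /path_weight big_filter [leRHS](bigID (fun z => z \notin Z)) /=.
by rewrite lerDl sumr_ge0.
Qed.

(** Following a path by its mirror image leads to the diagonal; the tail on the
diagonal thus controls all directions at once. *)
Lemma pass_sqr_le v (L : nat) x : level v = L%:Z ->
  pass v x ^+ 2 <= pass (L%:Z, L%:Z) (2%:R * x).
Proof.
move=> vL; apply: (@pass_mix _ _ _ _ _ omega_indep omega_id omega_ge0 1 1).
by move: vL; rewrite /level /shift /scale_site /flip /le_site /=; lia.
Qed.

Lemma grid_constraints_likely r : m0 < r -> exists N, forall m, (N <= m)%N ->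
  forall Q Z s, s \in grid_constraints m Q r -> 2%:R^-1 <= law (light Z s).
Proof.
move=> m0r; have e4 : 0 < 4%:R^-1 :> R by rewrite invr_gt0.
have [N hN] := shape_above m0P m0r e4.
exists N => m Nm Q Z _ /mapP[[[a1 a2] [c1 c2]] + ->].
rewrite mem_filter => /andP[/= /andP[ac1 ac2] _].
apply: le_trans (law_light _ _ _ _); set v := (_ - _, _ - _).
pose L := (((c1 * m) - (a1 * m)) + ((c2 * m) - (a2 * m)))%N.
have M (x y : nat) : (x < y)%N -> (x * m + m <= y * m)%N.
  by move=> xy; rewrite -mulSnr leq_mul2r xy orbT.
have h1 := M _ _ ac1; have h2 := M _ _ ac2.
have vL : level v = L%:Z by rewrite /level /v /L /=; move: h1 h2; clear; lia.
have vE : level (grid_site m (c1, c2)) - level (grid_site m (a1, a2)) = L%:Z.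
  by rewrite /level /L /grid_site /=; move: h1 h2; clear; lia.
have NL : (N <= L)%N by rewrite /L; move: h1 h2 Nm; clear; lia.
rewrite vE; have := pass_sqr_le (r * L%:R) vL.
have := hN L NL; rewrite -muln2 natrM => k1 k2.
have k3 : pass v (r * L%:R) ^+ 2 <= (2%:R^-1) ^+ 2.
  apply: (le_trans k2); rewrite (_ : 2%:R * _ = L%:R * 2%:R * r); last by ring.
  by rewrite (le_trans k1)// exprVn -natrX.
have k4 : pass v (r * L%:R) <= 2%:R^-1.
  by rewrite -(@ler_pXn2r _ 2)// nnegrE ?pass_ge0// invr_ge0.
rewrite -[L%:Z%:~R]/(L%:R); lra.
Qed.

(** For large [l] this is the law of large numbers, and each of the finitely
many smaller values is almost surely finite. *)
Lemma pass_diag_tight : exists b : R, forall l, (0 < l)%N ->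
  pass (l%:Z, l%:Z) (b * l%:R) <= 2%:R^-1.
Proof.
have m01 : m0 < `|m0| + 1 by have := ler_norm m0; lra.
have e2 : 0 < 2%:R^-1 :> R by rewrite invr_gt0.
have [N hN] := shape_above m0P m01 e2.
have small l : exists x : nat, pass (l%:Z, l%:Z) x%:R <= 2%:R^-1.
  have := @law_ae_eventually _ _ _ _ omega
    (fun n => reach (0, 0) (l%:Z, l%:Z) n%:R) (fun n => events_reachT _ _ _).
  move=> /(_ _ 2%:R^-1)[||x hx]; last by exists x; exact: hx.
    apply: aeW => w; set eta := weights omega w.
    pose B := \sum_(p <- paths_from l.*2 (0, 0)) `|path_weight eta p|.
    exists (Num.bound B) => n Bn [p pp np].
    have pin : p \in paths_from l.*2 (0, 0).
      by apply: mem_paths_from_up_right pp _; rewrite /level /=; lia.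
    have : path_weight eta p <= B.
      rewrite /B (big_rem p)//= (le_trans (ler_norm _))// lerDl.
      by apply: sumr_ge0.
    have : B < (Num.bound B)%:R by apply: archi_boundP; exact: sumr_ge0.
    have : (Num.bound B)%:R <= n%:R :> R by rewrite ler_nat.
    lra.
  by rewrite invr_gt0.
have [X hX] := choice small.
exists (2%:R * (`|m0| + 1) + (\sum_(l < N) X l)%:R) => l l0.
have l1 : 1 <= l%:R :> R by rewrite (ler_nat _ 1).
have m1 : 0 <= `|m0| by [].
have [Nl|lN] := leqP N l.
  apply: le_trans (hN l Nl); apply: pass_ge.
  rewrite -muln2 natrM; have : 0 <= (\sum_(l < N) X l)%:R * l%:R :> R.
    by rewrite mulr_ge0.
  lra.
apply: le_trans (hX l); apply: pass_ge.
have : (X l)%:R <= (\sum_(l < N) X l)%:R :> R.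
  by rewrite ler_nat (bigD1 (Ordinal lN))//= leq_addr.
have : 0 <= (\sum_(l < N) X l)%:R :> R by [].
nra.
Qed.

Lemma near_constraints_likely (b b0 : R) n p Z s :
  (forall l, (0 < l)%N -> pass (l%:Z, l%:Z) (b0 * l%:R) <= 2%:R^-1) -> b0 <= b ->
  s \in near_constraints n b p -> 2%:R^-1 <= law (light Z s).
Proof.
move=> hb0 bb /mapP[y + ->]; rewrite mem_filter => /andP[yn _].
have [l lE] : exists l : nat, n%:Z - level y = l%:Z.
  by exists (absz (n%:Z - level y)); move: yn; clear; lia.
have l0 : (0 < l)%N by move: yn lE; clear; lia.
rewrite lE; apply: le_trans (law_light _ _ _ _).
rewrite /shift /= !addrK.
have := hb0 l l0; have : pass (l%:Z, l%:Z) (b * l%:R) <= pass (l%:Z, l%:Z) (b0 * l%:R).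
  by apply: pass_ge; rewrite ler_wpM2r.
rewrite -[L in b * L]/(l%:R); lra.
Qed.

Variable t : R.

Definition heavy_chain (m j : nat) (r : R) : set (site -> R) :=
  [set eta | exists2 gam, up_right_path (0, 0) (scale_site j (target t m)) gam &
     heavy m r gam eta].

Lemma events_heavy m r gam : events [set` gam] (@heavy R m r gam).
Proof.
rewrite [X in events _ X](_ : _ = [set eta | forall k : nat, setT k ->
  `[r * ((size (drop k gam))%:R - m%:R), +oo[%classic
    (path_weight eta (drop k gam))]).
  apply: events_forall => k _; apply: events_sum => // z; exact: mem_drop.
apply/seteqP; split=> eta /= h k; first by rewrite in_itv/= andbT => _; exact: h.
by have := h k I; rewrite in_itv/= andbT.
Qed.

Lemma events_heavy_chain m j r :
  events [set z | level z <= level (scale_site j (target t m))] (heavy_chain m j r).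
Proof.
apply: (@events_exists R _ (seq site)
  [set gam | up_right_path (0, 0) (scale_site j (target t m)) gam]
  (heavy m r)) => gam /= gp.
apply: (events_sub _ (@events_heavy m r gam)) => z /= zg.
have /and3P[_ + _] := mem_up_right_path gp zg; rewrite /le_site /level; lia.
Qed.

(** Repeating [j] times the deviation of a block of length [m] yields a path
whose weight is spread evenly at scale [m]. *)
Lemma law_heavy_chain m j r : 0 <= r -> (0 < m)%N ->
  upper_tail omega t r m ^+ j <= law (heavy_chain m j r).
Proof.
move=> r0 m1; have eT j' : events setT (heavy_chain m j' r).
  by apply: (events_sub _ (@events_heavy_chain m j' r)).
elim: j => [|j IH].
  rewrite expr0 -(law_nonneg omega_ge0); apply: law_mono => //.
    exact: events_nonneg.
  move=> eta _; exists [::]; first by rewrite /scale_site !mul0r.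
  by move=> k; rewrite /= /path_weight big_nil mulr_ge0_le0// sub0r oppr_le0.
set u := scale_site j (target t m).
have uE : scale_site j.+1 (target t m) = shift u (target t m).
  by rewrite /u /shift /scale_site /= !intS !mulrDl !mul1r; congr pair; rewrite addrC.
have eR : events [set z | level u < level z]
    (@reach R u (shift u (target t m)) (r * m%:R)) by exact: events_reach.
have eRT : events setT (@reach R u (shift u (target t m)) (r * m%:R)).
  exact: events_reachT.
rewrite exprSr; apply: (@le_trans _ _ (law (heavy_chain m j r) * upper_tail omega t r m)).
  by rewrite ler_wpM2r ?pass_ge0.
rewrite /upper_tail -(law_reach_shift omega_indep omega_id u).
rewrite -(law_indep omega_indep (@events_heavy_chain m j r) eR); last first.
  by move=> z /=; rewrite ltNge => ->.
apply: law_mono_nonneg => //; first exact: eventsI.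
move=> eta eta0 [[gam gp gh] [q qq rq]].
exists (gam ++ q); first by rewrite uE; exact: up_right_path_cat qq.
apply: heavy_cat => //.
have := size_up_right_path qq; have /andP[_ +] := @level_target R t m.
rewrite /level /shift /=; move: (size q) (Num.floor _) (Num.floor _) => L x y.
by move: u.1 u.2; clear; lia.
Qed.

(** The events that a given index is the first successful one are disjoint, so
the bounds assumed for them add up. *)
Lemma law_select (I : eqType) (L : seq I) (A E : I -> set (site -> R)) (c : R) :
  (forall i, events setT (A i)) -> (forall i, events setT (E i)) ->
  (forall L1 i L2, L = L1 ++ i :: L2 ->
     law (A i `&` [set eta | forall j, j \in L1 -> ~ A j eta]) * c <=
     law ((A i `&` [set eta | forall j, j \in L1 -> ~ A j eta]) `&` E i)) ->
  law [set eta | exists2 i, i \in L & A i eta] * c <=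
  law [set eta | exists2 i, i \in L & (A i `&` E i) eta].
Proof.
move=> eA eE; elim/last_ind: L => [|L i IH] h.
  rewrite [X in law X * _](_ : _ = set0) ?law0 ?mul0r ?law_ge0//.
  by apply/seteqP; split=> eta // -[].
have ex (B : I -> set (site -> R)) (eB : forall j, events setT (B j)) (s : seq I) :
    events setT [set eta | exists2 j, j \in s & B j eta].
  elim: s => [|j s IHs].
    rewrite [X in events _ X](_ : _ = set0); first exact: events0.
    by apply/seteqP; split=> eta // -[].
  rewrite [X in events _ X](_ : _ = B j `|` [set eta | exists2 j, j \in s & B j eta]).
    exact: eventsU.
  apply/seteqP; split=> eta /=.
    by move=> [k]; rewrite inE => /orP[/eqP->|ks Bk]; [left|right; exists k].
  move=> [Bj|[k ks Bk]]; first by exists j; rewrite ?mem_head.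
  by exists k; rewrite // inE ks orbT.
have none : events setT [set eta | forall j, j \in L -> ~ A j eta].
  rewrite [X in events _ X](_ : _ = ~` [set eta | exists2 j, j \in L & A j eta]).
    by apply: eventsC; exact: ex.
  apply/seteqP; split=> eta /=; first by move=> nA [j jL /nA]; apply.
  by move=> nA j jL Aj; apply: nA; exists j.
have eAE j : events setT (A j `&` E j) by exact: eventsI.
set U := A i `&` [set eta | forall j, j \in L -> ~ A j eta].
have eU : events setT U by exact: eventsI.
have -> : [set eta | exists2 j, j \in rcons L i & A j eta] =
    [set eta | exists2 j, j \in L & A j eta] `|` U.
  apply/seteqP; split=> eta /=.
    move=> [j]; rewrite mem_rcons inE => jL Aj.
    have [[k kL Ak]|nA] := pselect (exists2 k, k \in L & A k eta).
      by left; exists k.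
    right; case/orP: jL => [/eqP ji|jL]; last by exfalso; apply: nA; exists j.
    by split; [rewrite -ji|move=> k kL Ak; apply: nA; exists k].
  move=> [[j jL Aj]|[Ai _]]; first by exists j; rewrite // mem_rcons inE jL orbT.
  by exists i; rewrite // mem_rcons mem_head.
apply: (@le_trans _ _ (law ([set eta | exists2 j, j \in L & (A j `&` E j) eta] `|`
    (U `&` E i)))); last first.
  apply: law_mono; [by apply: eventsU; [exact: ex|exact: eventsI]|exact: ex|].
  move=> eta [[j jL AEj]|[[Ai _] Ei]]; first by exists j; rewrite // mem_rcons inE jL orbT.
  by exists i; rewrite // mem_rcons mem_head.
have disj (B C : set (site -> R)) : events setT B -> events setT C ->
    B `&` C = set0 -> law (B `|` C) = law B + law C.
  by move=> eB eC BC; rewrite -lawUI// BC law0 addr0.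
rewrite !disj; [|exact: ex|exact: eventsI| |exact: ex|by []|]; last 2 first.
- by apply/seteqP; split=> eta // -[[j jL [Aj _]] [[_ /(_ j jL)]]].
- by apply/seteqP; split=> eta // -[[j jL Aj] [_ /(_ j jL)]].
rewrite mulrDl lerD//; last by apply: (h L i [::]); rewrite cats1.
by apply: IH => L1 j L2 LE; apply: (h L1 j (rcons L2 i)); rewrite LE rcons_cat.
Qed.

End PlantedPath.

Section PlantedProbability.
Variables (R : realType) (d : measure_display) (T : measurableType d).
Variables (P : probability T R) (omega : site -> {RV P >-> R}).
Hypothesis omega_indep : mutually_independent omega.
Hypothesis omega_id : identically_distributed omega.
Hypothesis omega_ge0 : forall z, {ae P, forall w, 0 <= omega z w}.
Hypothesis omega_unbounded : forall z (beta : R),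
  (0 < P [set w | (beta < omega z w)%R])%E.
Variable t : R.
Hypothesis t_bounds : 0 < t <= 1 / 2.
Local Notation law := (law omega).

Definition square_sites (B : nat) : seq site :=
  [seq grid_site 1 a | a <- grid B].

Lemma mem_square_sites B z : le_site (0, 0) z -> le_site z (B%:Z, B%:Z) ->
  z \in square_sites B.
Proof.
case: z => z1 z2 /andP[/= z10 z20] /andP[/= h1 h2].
apply/mapP; exists (absz z1, absz z2); last first.
  by rewrite /grid_site /= !muln1; congr pair; [move: z10|move: z20]; clear; lia.
by rewrite mem_grid; apply/andP; split; [move: z10 h1|move: z20 h2]; clear; lia.
Qed.

Lemma grid_constraints_bound m Q (r : R) s : s \in grid_constraints m Q r ->
  le_site (0, 0) s.1.1 /\ le_site s.1.2 ((Q * m)%N%:Z, (Q * m)%N%:Z).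
Proof.
move=> /mapP[[[a1 a2] [c1 c2]] + ->]; rewrite mem_filter => /andP[_].
move=> /allpairsP[[a c] /= [_ + [_ E]]]; rewrite -E mem_grid => /andP[h1 h2].
split; first by [].
by apply/andP; split=> /=; rewrite lez_nat leq_mul2r ?h1 ?h2 orbT.
Qed.

Lemma near_constraints_bound n (b : R) p s :
  (forall y, y \in p -> le_site (0, 0) y) -> s \in near_constraints n b p ->
  le_site (0, 0) s.1.1 /\ le_site s.1.2 (n.*2%:Z, n.*2%:Z).
Proof.
move=> hp /mapP[y + ->]; rewrite mem_filter => /andP[yn /hp y0] /=.
split=> //; move: yn y0; rewrite /le_site /level /shift /=; clear; lia.
Qed.

(** The probability that the endpoint is [v], bounded below by three
requirements: an evenly heavy path to the end [u] of the blocks, large weights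
on a fixed path from [u] to [v], and no exceptional weights elsewhere. The
last one is decoupled from the first by the Harris inequality, since the event
that a given path is the first heavy one is decreasing in the weights off it;
the second one concerns sites beyond the level of [u] that are excluded from
the constraints, and is independent of both. *)
Lemma planted_prob (n m j : nat) (b r : R) (v : site) (fin : seq site) :
  ~~ odd n -> 0 <= r -> 6%:R * r <= b -> (0 < m <= size fin)%N -> (m <= n)%N ->
  up_right_path (scale_site j (target t m)) v fin -> level v = n%:Z ->
  let S := grid_constraints m (n %/ m).+1 r ++
    near_constraints n b (scale_site j (target t m) :: fin) in
  (forall Z s, s \in S -> 2%:R^-1 <= law (light Z s)) ->
  upper_tail omega t r m ^+ j * ((2%:R^-1) ^+ size S * tail_prob omega b ^+ size fin) <=
  law [set eta | line_endpoint eta n = v].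
Proof.
move=> n2 r0 rb mfin mn fp vn; set u := scale_site j _ => S hS.
have /andP[m0 _] := mfin.
have u0 : le_site (0, 0) u.
  have := target_ge0 t_bounds m; rewrite /u /le_site /scale_site /=.
  by move=> /andP[h1 h2]; rewrite !mulr_ge0.
have uv := up_right_path_le fp.
have [k kE] : exists k : nat, level u = k%:Z.
  by exists (absz (level u)); move: u0; rewrite /le_site /level /=; clear; lia.
have finE z : z \in fin -> [&& le_site u z, le_site z v & level u < level z].
  exact: mem_up_right_path fp.
have vB : le_site v (n.*2%:Z, n.*2%:Z).
  by move: u0 uv vn; rewrite /le_site /level /=; clear; lia.
have SB s : s \in S -> le_site (0, 0) s.1.1 /\ le_site s.1.2 (n.*2%:Z, n.*2%:Z).
  rewrite mem_cat => /orP[/grid_constraints_bound[h1 h2]|].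
    split=> //; have : ((n %/ m).+1 * m <= n.*2)%N.
      rewrite mulSn -addnn leq_add// leq_divM//.
    by move: h2; rewrite /le_site /=; move: (_.+1 * m)%N; clear; lia.
  apply: near_constraints_bound => y; rewrite inE => /orP[/eqP->//|/finE/and3P[uy _ _]].
  exact: le_site_trans u0 uy.
pose L := [seq gam <- paths_from k (0, 0) | last (0, 0) gam == u].
have LE gam : (gam \in L) = up_right_path (0, 0) u gam.
  rewrite mem_filter mem_paths_from /up_right_path.
  apply/andP/andP => [[lu /andP[_ pp]]|[pp lu]]; split=> //.
  rewrite pp andbT; have := @size_up_right_path (0, 0) u gam.
  rewrite /up_right_path pp lu kE /level => /(_ isT).
  by move: (size gam) => l /=; clear; lia.
pose E gam : set (site -> R) :=
  [set eta | forall D, D \in [seq light (gam ++ fin) s | s <- S] -> D eta] `&`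
  [set eta | forall z, z \in fin -> b < eta z].
have elight Z (F : set site) : (forall z, z \notin Z -> z \in square_sites n.*2 -> F z) ->
    events F [set eta : site -> R | forall D, D \in [seq light Z s | s <- S] -> D eta].
  move=> hF; rewrite [X in events _ X](_ : _ =
    [set eta | forall s, s \in S -> light Z s eta]); last first.
    apply/seteqP; split=> eta /= h.
      by move=> s sS; apply: h; exact: map_f.
    by move=> D /mapP[s sS ->]; exact: h.
  suff h (S' : seq (site * site * R)) : {subset S' <= S} ->
    events F [set eta : site -> R | forall s, s \in S' -> light Z s eta].
    exact: h.
  elim: S' => [|s S' IH] sub.
    rewrite [X in events _ X](_ : _ = setT); first exact: eventsT.
    by apply/seteqP; split.
  rewrite [X in events _ X](_ : _ = light Z s `&`
    [set eta : site -> R | forall s, s \in S' -> light Z s eta]).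
    apply: eventsI; last by apply: IH => x xs; apply: sub; rewrite inE xs orbT.
    apply: events_light => z zZ h1 h2 _; apply: hF => //.
    have [s1 s2] := SB s (sub s (mem_head _ _)).
    by apply: mem_square_sites; [exact: le_site_trans s1 h1|exact: le_site_trans h2 s2].
  apply/seteqP; split=> eta /=.
    by move=> h; split=> [|x xs]; apply: h; rewrite inE ?eqxx// xs orbT.
  by move=> [h1 h2] x; rewrite inE => /orP[/eqP->|/h2].
have efin : events [set` fin] [set eta : site -> R | forall z, z \in fin -> b < eta z].
  by apply: (@events_forall R _ site [set` fin]) => z zf; exact: events_gt.
have efinT : events setT [set eta : site -> R | forall z, z \in fin -> b < eta z].
  by apply: (events_sub _ efin).
have eA gam : events setT (@heavy R m r gam).
  by apply: (events_sub _ (@events_heavy R m r gam)).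
have eE gam : events setT (E gam) by apply: eventsI => //; exact: elight.
have c0 : 0 <= 2%:R^-1 :> R by rewrite invr_ge0.
have eX (B : seq site -> set (site -> R)) : (forall gam, events setT (B gam)) ->
    events setT [set eta | exists2 gam, gam \in L & B gam eta].
  by move=> eB; exact: (@events_exists R setT (seq site) [set` L] B).
have eEnd : events setT [set eta : site -> R | line_endpoint eta n = v].
  exact: (@events_line_endpoint R [set z | z = v]).
apply: (@le_trans _ _ (law [set eta | exists2 gam, gam \in L &
    (heavy m r gam `&` E gam) eta])); last first.
  apply: law_mono_nonneg => //; first by apply: eX => gam; exact: eventsI.
  move=> eta eta0 [gam gL [gh [gS gf]]].
  rewrite LE in gL; have fp' := up_right_path_cat gL fp.
  apply: (planted_endpoint n2 eta0 r0 rb mfin gL fp _ gh gf) => //.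
    have := size_up_right_path fp'; rewrite size_cat vn /level /=.
    by move: (size gam + size fin)%N; clear; lia.
  by move=> s sS; apply: gS; exact: map_f.
have chain : upper_tail omega t r m ^+ j <= law [set eta | exists2 gam, gam \in L & heavy m r gam eta].
  apply: le_trans (law_heavy_chain omega_indep omega_id omega_ge0 t j r0 m0) _.
  rewrite (_ : heavy_chain t m j r = [set eta | exists2 gam, gam \in L & heavy m r gam eta])//.
  by apply/seteqP; split=> eta [gam gp gh]; exists gam => //; move: gp; rewrite LE.
set c := _ * _ ^+ size fin; have cge0 : 0 <= c.
  by rewrite mulr_ge0 ?exprn_ge0// ltW// tail_prob_gt0.
apply: le_trans (ler_wpM2r cge0 chain) _.
apply: law_select => // L1 gam L2 LLE.
have L1L g : g \in L1 -> up_right_path (0, 0) u g.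
  by move=> gL; rewrite -LE LLE mem_cat gL.
have gp : up_right_path (0, 0) u gam by rewrite -LE LLE mem_cat mem_head orbT.
set U := _ `&` _; set F := [seq z <- square_sites n.*2 | z \notin fin].
have sub g : up_right_path (0, 0) u g -> {subset g <= F}.
  move=> gg z zg; have /and3P[h1 h2 h3] := mem_up_right_path gg zg.
  rewrite mem_filter; apply/andP; split.
    apply/negP => /finE/and3P[_ _ h4]; move: h2 h4; rewrite /le_site /level; clear; lia.
  by apply: mem_square_sites => //; exact: le_site_trans (le_site_trans h2 uv) vB.
have eU : events [set` F] U.
  apply: eventsI.
    apply: (events_sub _ (@events_heavy R m r gam)) => z; exact: sub.
  rewrite [X in events _ X](_ : _ =
    [set eta | forall g, [set` L1] g -> (~` heavy m r g) eta])//.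
  apply: events_forall => g /= gL; apply: eventsC.
  apply: (events_sub _ (@events_heavy R m r g)) => z; apply: sub; exact: L1L.
have dU z : z \in [seq z <- square_sites n.*2 | z \notin gam ++ fin] -> decreasing_at z U.
  rewrite mem_filter mem_cat negb_or => /andP[/andP[zg _] _] eta eta' h1 h2.
  have le := decreasing_le h1 h2.
  move=> [hv hn]; split.
    move=> i; rewrite (le_trans (hv i))// le_eqVlt; apply/orP; left; apply/eqP.
    apply: eq_big_seq => y yg; rewrite h1//; apply: contraNneq zg => <-.
    exact: mem_drop yg.
  move=> g gL hg; apply: (hn g gL) => i; apply: le_trans (hg i) _.
  by apply: ler_sum.
have har : law U * 2%:R^-1 ^+ size S <=
  law (U `&` [set eta | forall D, D \in [seq light (gam ++ fin) s | s <- S] -> D eta]).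
  rewrite -(size_map (light (gam ++ fin)) S).
  apply: (harris_seq omega_indep omega_id c0 _ eU dU).
  - by move=> z; rewrite !mem_filter mem_cat negb_or => /andP[/andP[_ ->] ->].
  - move=> D /mapP[s sS ->]; split; last exact: hS.
      apply: events_light => z zZ h1 h2 _.
      suff : z \in [seq z <- square_sites n.*2 | z \notin gam ++ fin] by [].
      rewrite mem_filter zZ andTb.
      have [s1 s2] := SB s sS.
      by apply: mem_square_sites; [exact: le_site_trans s1 h1|exact: le_site_trans h2 s2].
    by move=> z; exact: decreasing_light.
have q0 : 0 <= tail_prob omega b ^+ size fin.
  by rewrite exprn_ge0// ltW// tail_prob_gt0.
rewrite /c mulrA; apply: le_trans (ler_wpM2r q0 har) _.
rewrite /E setIA [leRHS](law_indep omega_indep (F := [set` F]) (G := [set` fin])) //.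
- by rewrite ler_wpM2l ?law_ge0//; exact: law_all_gt.
- apply: eventsI => //; apply: elight => z zZ zB.
  suff : z \in F by [].
  by rewrite mem_filter zB andbT; apply: contra zZ; rewrite mem_cat => ->; rewrite orbT.
- move=> z zF zf; have : z \in F by [].
  by rewrite mem_filter => /andP[/negP].
Qed.

End PlantedProbability.

(** * The lower bound and the theorem *)

Section LowerBound.
Variables (R : realType) (d : measure_display) (T : measurableType d).
Variables (P : probability T R) (omega : site -> {RV P >-> R}).
Hypothesis omega_indep : mutually_independent omega.
Hypothesis omega_id : identically_distributed omega.
Hypothesis omega_ge0 : forall z, {ae P, forall w, 0 <= omega z w}.
Hypothesis omega_unbounded : forall z (beta : R),
  (0 < P [set w | (beta < omega z w)%R])%E.
Variable m0 : R.
Hypothesis m0P : is_shape_value omega 0 m0.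
Local Notation law := (law omega).

Lemma shape_value_ge0 : 0 <= m0.
Proof.
rewrite leNgt; apply/negP => m0n; have e2 : 0 < 2%:R^-1 :> R by rewrite invr_gt0.
have [N hN] := shape_above m0P m0n e2.
have := hN N (leqnn N); rewrite mulr0 pass_nonpos//.
by lra.
Qed.

Variable t : R.
Hypothesis t_bounds : 0 < t <= 1 / 2.
Local Notation J := (rate_fun omega t).

Definition ends_at n : set (site -> R) :=
  [set eta | (line_endpoint eta n).1 = Num.floor (n%:R / 2 + t * n%:R : R)].

Lemma events_ends_at n : ~~ odd n -> events setT (ends_at n).
Proof.
exact: (@events_line_endpoint R
  [set z : site | z.1 = Num.floor (n%:R / 2 + t * n%:R : R)]).
Qed.

(** Integer parts lose at most one unit of level in each of the [k] blocks, and
the division of [n] by [k + 1] another [k], whence the slack [2 (k + 1)] in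
the length of the final segment. *)
Lemma last_block k m n : (0 < m)%N -> (k.+1 * m <= n < k.+1 * m + k.+1)%N ->
  let u := scale_site k (target t m) in
  let x := Num.floor (n%:R / 2 + t * n%:R : R) in
  exists fin, up_right_path u (x, n%:Z - x) fin /\
    (m <= size fin <= m + k.+1.*2)%N.
Proof.
move=> m1 /andP[kmn nkm] u x; have /andP[t0 t2] := t_bounds.
have kmR : k%:R * m%:R <= n%:R :> R.
  by rewrite -natrM ler_nat (leq_trans _ kmn)// leq_mul2r leqnSn orbT.
have k0 : 0 <= k%:R :> R by [].
have /andP[h1 h2] := target_le t m.
have /andP[h3 h4] := floor_itv (n%:R / 2 + t * n%:R : R).
have k1 : k%:R * (m%:R / 2 + t * m%:R) <= n%:R / 2 + t * n%:R.
  have : k%:R * m%:R * (1 / 2 + t) <= n%:R * (1 / 2 + t) by rewrite ler_wpM2r//; lra.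
  lra.
have k2 : k%:R * (m%:R / 2 - t * m%:R) <= n%:R / 2 - t * n%:R.
  have : k%:R * m%:R * (1 / 2 - t) <= n%:R * (1 / 2 - t) by rewrite ler_wpM2r//; lra.
  lra.
have ux : u.1 <= x.
  rewrite floor_ge_int /u /scale_site intrM (le_trans _ k1)//.
  by rewrite ler_wpM2l.
have uy : u.2 <= n%:Z - x.
  rewrite -(ler_int R) rmorphB /= /u /scale_site intrM.
  have : k%:R * (target t m).2%:~R <= k%:R * (m%:R / 2 - t * m%:R) :> R.
    by rewrite ler_wpM2l.
  by rewrite -/x in h3; rewrite -[k%:Z%:~R]/(k%:R) -[n%:Z%:~R]/(n%:R); lra.
have [|fin fp] := @up_right_path_exists u (x, n%:Z - x).
  by rewrite /le_site ux.
exists fin; split=> //; have := size_up_right_path fp.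
have uE : level u = k%:Z * level (target t m).
  by rewrite /level /u /scale_site /= mulrDr.
rewrite uE; have := @level_target R t m; move: (level (target t m)) => l.
rewrite /level /= [x + _]addrC subrK; move: (size fin) kmn nkm; clear.
move=> s; rewrite !mulSn => h1 h2 /andP[h3 h4] sE.
have k1 : k%:Z * (m%:Z - 1) <= k%:Z * l by rewrite ler_wpM2l.
have k2 : k%:Z * l <= k%:Z * m%:Z by rewrite ler_wpM2l.
by rewrite mulrBr mulr1 in k1; move: (k%:Z * l) k1 k2 sE; lia.
Qed.

(** The number [k + 1] of blocks is chosen after the threshold [b], hence after
the cost per step [lam] of the final segment and its constraints, so that a
proportion [1 / (k + 1)] of steps at that cost is negligible. *)
Lemma ends_at_ge e : 0 < e -> exists N0, forall h, (N0 <= h)%N ->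
  expR (- (h.*2%:R * (J m0 + e))) <= law (ends_at h.*2).
Proof.
move=> e0; have e4 : 0 < e / 4%:R by lra.
have m00 := shape_value_ge0.
have [del del0 hdel] := rate_fun_right omega_indep omega_id omega_ge0
  omega_unbounded t_bounds m0 e4.
pose r := m0 + del; have m0r : m0 < r by rewrite /r; lra.
have r0 : 0 <= r by lra.
have [b0 hb0] := pass_diag_tight m0P.
pose b := 6%:R * r + `|b0|.
have rb : 6%:R * r <= b by rewrite /b lerDl.
have b0b : b0 <= b by rewrite /b (le_trans (ler_norm b0))// lerDr mulr_ge0.
have tb := tail_prob_gt0 omega_unbounded b.
pose lt := - ln (tail_prob omega b).
have lt0 : 0 <= lt by rewrite oppr_ge0 ln_le0// tail_prob_le1.
have ln2 : 0 <= ln 2%:R :> R by rewrite ln_ge0// ler1n.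
pose lam := ln 2%:R + lt; have lam0 : 0 <= lam by rewrite addr_ge0.
have [k hk] : exists k : nat, lam <= k.+1%:R * (e / 4%:R).
  exists (Num.bound (lam / (e / 4%:R))); rewrite -ler_pdivrMr// ltW//.
  apply: lt_le_trans (archi_boundP _) _; first by rewrite divr_ge0// ltW.
  by rewrite ler_nat.
pose C := (k.+3 * k.+3 * (k.+3 * k.+3))%N.
pose D := C.+1%:R * ln 2%:R + k.+1.*2%:R * lam.
have D0 : 0 <= D by rewrite addr_ge0// mulr_ge0.
have [N1 hN1] : exists N1 : nat, D <= N1%:R * (e / 4%:R).
  exists (Num.bound (D / (e / 4%:R))); rewrite -ler_pdivrMr// ltW//.
  by apply: archi_boundP; rewrite divr_ge0// ltW.
have [N2 hN2] := upper_tail_ge omega_indep omega_id omega_ge0 omega_unbounded t_bounds r e4.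
have [N3 hN3] := grid_constraints_likely omega_indep omega_id omega_ge0 m0P m0r.
pose M := (N2 + N3 + k.+1)%N.
exists (N1 + k.+1 * M)%N => h hh; set n := h.*2.
have n2 : ~~ odd n by rewrite odd_double.
have hn : (h <= n)%N by rewrite /n -addnn leq_addr.
have N1n : (N1 <= n)%N by apply: leq_trans hn; apply: leq_trans hh; exact: leq_addr.
have kMn : (k.+1 * M <= n)%N.
  by apply: leq_trans hn; apply: leq_trans hh; exact: leq_addl.
pose m := (n %/ k.+1)%N.
have Mm : (M <= m)%N by rewrite /m leq_divRL// mulnC.
have N2m : (N2 <= m)%N by apply: leq_trans Mm; rewrite /M -addnA leq_addr.
have N3m : (N3 <= m)%N.
  by apply: leq_trans Mm; rewrite /M addnAC leq_addl.
have km : (k.+1 <= m)%N by apply: leq_trans Mm; rewrite leq_addl.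
have m1 : (0 < m)%N by apply: leq_trans km.
have kmn : (k.+1 * m <= n)%N by rewrite mulnC leq_divM.
have nkm : (n < k.+1 * m + k.+1)%N.
  by rewrite -mulnSr mulnC; exact: ltn_ceil.
have nm : (n %/ m <= k.+1)%N.
  rewrite -ltnS ltn_divLR// mulSn addnC (leq_trans nkm)// leq_add2l//.
have [|fin [fp /andP[mf fm]]] := @last_block k m n m1; first by rewrite kmn.
set x := Num.floor _ in fp; set u := scale_site _ _ in fp.
apply: (@le_trans _ _ (law [set eta | line_endpoint eta n = (x, n%:Z - x)])); last first.
  apply: law_mono.
  - exact: (@events_line_endpoint R [set z | z = (x, n%:Z - x)]).
  - exact: events_ends_at.
  by move=> eta E; rewrite /ends_at /mkset (_ : line_endpoint eta n = (x, n%:Z - x)).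
apply: le_trans (planted_prob omega_indep omega_id omega_ge0 omega_unbounded
  t_bounds n2 r0 rb _ _ fp _ _); first last.
- move=> Z s; rewrite mem_cat => /orP[|].
    exact: hN3.
  exact: (near_constraints_likely omega_indep omega_id omega_ge0 Z hb0 b0b).
- by rewrite /level /= addrC subrK.
- by apply: leq_trans kmn; exact: leq_pmull.
- by rewrite m1.
set S := _ ++ _.
have sS : (size S <= C.+1 + size fin)%N.
  rewrite size_cat addSnnS leq_add//.
    apply: leq_trans (size_grid_constraints _ _ _) _.
    by rewrite !leq_mul.
  by rewrite (leq_trans (size_near_constraints _ _ _)).
have u1 : expR (- (n%:R * (J m0 + e / 2))) <= upper_tail omega t r m ^+ k.
  apply: (@le_trans _ _ (expR (- (m%:R * (J r + e / 4%:R))) ^+ k)).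
    rewrite -expRM_natl ler_expR mulrN lerN2 mulrA -natrM.
    have kmn' : (k * m)%:R <= n%:R :> R.
      by rewrite ler_nat (leq_trans _ kmn)// leq_mul2r leqnSn orbT.
    have Jr0 : 0 <= J r by exact: rate_fun_ge0.
    apply: (@le_trans _ _ (n%:R * (J r + e / 4%:R))).
      by rewrite ler_wpM2r//; lra.
    by rewrite ler_wpM2l//; rewrite -/r in hdel; lra.
  by apply: lerXn2r; rewrite ?nnegrE ?expR_ge0 ?pass_ge0// hN2.
have fR : (size fin)%:R * lam <= n%:R * (e / 4%:R) + k.+1.*2%:R * lam.
  apply: (@le_trans _ _ ((m + k.+1.*2)%:R * lam)).
    by rewrite ler_wpM2r// ler_nat.
  rewrite natrD mulrDl lerD2r; apply: (@le_trans _ _ (m%:R * (k.+1%:R * (e / 4%:R)))).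
    by rewrite ler_wpM2l.
  rewrite mulrA -natrM ler_wpM2r//; first exact: ltW.
  by rewrite ler_nat mulnC.
have u2 : expR (- (n%:R * (e / 2))) <=
    2%:R^-1 ^+ size S * tail_prob omega b ^+ size fin.
  have q2 : 2%:R^-1 = expR (- ln 2%:R) :> R by rewrite expRN lnK// posrE.
  rewrite [in leRHS]q2.
  have -> : tail_prob omega b = expR (- lt) by rewrite opprK lnK// posrE.
  rewrite -!expRM_natl -expRD ler_expR !mulrN -opprD lerN2.
  have s1 : (size S)%:R * ln 2%:R <= (C.+1%:R + (size fin)%:R) * ln 2%:R :> R.
    by apply: ler_wpM2r => //; rewrite -natrD ler_nat.
  have s2 : N1%:R * (e / 4%:R) <= n%:R * (e / 4%:R).
    by rewrite ler_wpM2r ?ler_nat// ltW.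
  by move: fR s1 s2 hN1; rewrite /D /lam /lt; lra.
apply: le_trans (ler_pM _ _ u1 u2); rewrite ?expR_ge0//.
by rewrite -expRD ler_expR; lra.
Qed.

End LowerBound.

Lemma cvg_log_rate (R : realType) (f : nat -> R) (J : R) :
  (forall e, 0 < e -> exists N, forall k, (N <= k)%N ->
     expR (- (k.*2%:R * (J + e))) <= f k <= expR (- (k.*2%:R * (J - e)))) ->
  (fun k : nat => - (((k.*2)%:R^-1)%:E * lne (f k)%:E))%E @ \oo --> J%:E.
Proof.
move=> hf; have fE k : 0 < f k ->
    (- (((k.*2)%:R^-1)%:E * lne (f k)%:E))%E = (- (k.*2%:R^-1 * ln (f k)))%:E.
  by move=> f0; rewrite lne_EFin.
apply/fine_cvgP; split.
  have [N hN] := hf 1 ltr01; exists N => // k /= /hN/andP[+ _].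
  by move=> /(lt_le_trans (expR_gt0 _)) /fE ->.
apply/cvgrPdist_le => e e0; have [N hN] := hf e e0.
exists N.+1 => // k /= Nk; have /andP[h1 h2] := hN k (ltnW Nk).
have f0 := lt_le_trans (expR_gt0 _) h1; rewrite fE//=.
have k0 : 0 < k.*2%:R :> R by rewrite ltr0n double_gt0 (leq_trans _ Nk).
have {}h1 : - (k.*2%:R * (J + e)) <= ln (f k).
  by rewrite -[leLHS]expRK ler_ln ?posrE ?expR_gt0.
have {}h2 : ln (f k) <= - (k.*2%:R * (J - e)).
  by rewrite -[leRHS]expRK ler_ln ?posrE ?expR_gt0.
rewrite opprK ler_norml -(ler_pM2l k0) -[X in _ && X](ler_pM2l k0).
by rewrite mulrDr mulrA divff ?lt0r_neq0// mul1r; apply/andP; split; lra.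
Qed.

Theorem proposition1p2 (R : realType) (d : measure_display)
    (T : measurableType d) (P : probability T R)
    (omega : int * int -> {RV P >-> R})
    (omega_indep : mutually_independent omega)
    (omega_id : identically_distributed omega)
    (omega_ge0 : forall z, {ae P, forall w, 0 <= omega z w})
    (omega_cdf : forall z, continuous (cdf (omega z)))
    (omega_exp : exists2 alpha : R, 0 < alpha &
       forall z, ('M_P (omega z) alpha < +oo)%E)
    (omega_unbounded : forall z (beta : R),
       (0 < P [set w | (beta < omega z w)%R])%E)
    (mu : R -> R)
    (mu_shape : forall s : R, - (1 / 2) <= s <= 1 / 2 ->
       is_shape_value omega s (mu s))
    (t : R) (t_bounds : 0 < t <= 1 / 2) (mu_gap : mu t < mu 0) :
  (forall eps : R, 0 < eps -> exists n0 : nat, forall n : nat,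
     ~~ odd n -> (n0 <= n)%N ->
     [/\ (expeR (- (n%:R%:E * (rate omega t (mu 0%R) + eps%:E)))
            <= P (end_eq omega t n))%E,
         (P (end_eq omega t n) <= P (end_ge omega t n))%E &
         (P (end_ge omega t n)
            <= expeR (- (n%:R%:E * (rate omega t (mu 0%R) - eps%:E))))%E]) /\
  ((fun k : nat => - (((k.*2)%:R^-1)%:E * lne (P (end_eq omega t k.*2))))%E
     @ \oo --> rate omega t (mu 0%R)) /\
  ((fun k : nat => - (((k.*2)%:R^-1)%:E * lne (P (end_ge omega t k.*2))))%E
     @ \oo --> rate omega t (mu 0%R)).
Proof.
have m0P : is_shape_value omega 0 (mu 0) by apply: mu_shape; lra.
rewrite (rateE omega_indep omega_id omega_ge0 omega_unbounded t_bounds).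
set J := rate_fun omega t (mu 0).
have eqE n : ~~ odd n -> P (end_eq omega t n) = (law omega (ends_at t n))%:E.
  by move=> n2; rewrite lawE//; exact: events_ends_at.
have geE n : ~~ odd n -> P (end_ge omega t n) = (law omega (ends_beyond t n))%:E.
  by move=> n2; rewrite lawE//; exact: events_ends_beyond.
have incl n : ~~ odd n -> law omega (ends_at t n) <= law omega (ends_beyond t n).
  move=> n2; apply: law_mono; [exact: events_ends_at|exact: events_ends_beyond|].
  by move=> eta /= h; rewrite /ends_beyond /= h.
have bounds e : 0 < e -> exists N, forall h, (N <= h)%N ->
    expR (- (h.*2%:R * (J + e))) <= law omega (ends_at t h.*2) /\
    law omega (ends_beyond t h.*2) <= expR (- (h.*2%:R * (J - e))).
  move=> e0; have [N1 h1] := ends_at_ge omega_indep omega_id omega_ge0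
    omega_unbounded m0P t_bounds e0.
  have [N2 h2] := ends_beyond_le omega_indep omega_id omega_ge0
    omega_unbounded t_bounds m0P e0.
  exists (N1 + N2)%N => h hN; split; [apply: h1|apply: h2]; apply: leq_trans hN.
    exact: leq_addr.
  exact: leq_addl.
have even k : ~~ odd k.*2 by rewrite odd_double.
split; last split.
- move=> e /bounds[N hN]; exists N.*2 => n n2 Nn.
  have nE : n = n./2.*2 by rewrite -[LHS]odd_double_half (negbTE n2).
  have [h1 h2] := hN n./2 ltac:(by rewrite -leq_double -nE).
  rewrite -nE in h1 h2; rewrite eqE// geE//.
  rewrite -EFinD -EFinB -!EFinM -!EFinN /= !lee_fin.
  by split=> //; exact: incl.
- under eq_fun do rewrite eqE//.
  apply: cvg_log_rate => e /bounds[N hN]; exists N => k /hN[-> h2] /=.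
  exact: le_trans (incl _ (even k)) h2.
- under eq_fun do rewrite geE//.
  apply: cvg_log_rate => e /bounds[N hN]; exists N => k /hN[h1 ->].
  by rewrite (le_trans h1)//; exact: incl.
Qed.
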